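(* Let $p\in(0,+\infty]$, $v\in S^{n-1}$, let $K\subset\mathbb{R}^n$ be a convex body and let $K_t$ be a parallel chord movement of $K$ along the direction $v$, with set of admissible times $T\subset\mathbb{R}$. Then for all $s\in\mathbb{R}$ and all $t_1,t_2\in T$, $$\Big|K_{\frac{t_1+t_2}{2}}^{o,p}(s)\Big|^{\frac{1}{n-1}}\geq \frac12\Big|K_{t_1}^{o,p}(s)\Big|^{\frac{1}{n-1}}+\frac12\Big|K_{t_2}^{o,p}(s)\Big|^{\frac{1}{n-1}}.$$
   Context: A convex body in $\mathbb{R}^n$ is a compact convex set with non-empty interior; $|\cdot|$ denotes $k$-dimensional volume in the appropriate dimension $k\le n$ ($(n-1)$-dimensional volume in $v^\perp$ for the sections $K^{o,p}_t(s)$); $\langle\cdot,\cdot\rangle$ is the standard inner product, $S^{n-1}$ the unit sphere. $L_p$ support function: for $p\in(0,\infty)$ and a convex body $K$, $h_{p,K}(y)=\frac1p\log\Big(\frac{1}{|K|}\int_K e^{p\langle x,y\rangle}dx\Big)$; for $p=\infty$, $h_{\infty,K}(y)=h_K(y)=\max_{x\in K}\langle x,y\rangle$. $L_p$ polar body: $K^{o,p}=\{y\in\mathbb{R}^n:\|y\|_{K^{o,p}}\le1\}$, where $\|y\|_{K^{o,p}}=\Big(\frac{1}{(n-1)!}\int_0^\infty r^{n-1}e^{-h_{p,K}(ry)}dr\Big)^{-1/n}$ (equal to $0$ if the integral is $+\infty$); $K^{o,\infty}=K^o$ is the usual polar body $\{y:\langle x,y\rangle\le1\ \forall x\in K\}$.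 Sections: for $v\in S^{n-1}$, $v^\perp=\{x:\langle x,v\rangle=0\}$, and for a set $A\subset\mathbb{R}^n$ and $s\in\mathbb{R}$, $A(s)=\{x'\in v^\perp: x'+sv\in A\}$; thus $K_t^{o,p}(s)=(K_t)^{o,p}(s)$. Parallel chord movement: let $K|v^\perp$ be the orthogonal projection of $K$ onto $v^\perp$. Given a continuous function $\beta:K|v^\perp\to\mathbb{R}$ (the speed function), put $K_t=\{x+\beta(x|v^\perp)\,t\,v: x\in K\}$. The admissible times are those at which $K_t$ is convex: $T=\{t\in\mathbb{R}:K_t\text{ is convex}\}$ (this set is an interval containing $0$).
   Formalization: The inequality is proved under the added assumption that whenever one of the two sections at t_1, t_2 has positive volume the other is non-empty; without it the claim fails (unit disc translated along v, p = ∞, s = 1, t_1 = -1/2, t_2 = 1/2). *)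

(* Defs.v *)
From HB Require Import structures.
From mathcomp Require Import all_boot all_order all_algebra.
From mathcomp Require Import all_classical all_reals all_analysis.

Set Implicit Arguments.
Unset Strict Implicit.
Unset Printing Implicit Defensive.

Import Order.TTheory GRing.Theory Num.Theory.
Import numFieldNormedType.Exports.

Local Open Scope classical_set_scope.
Local Open Scope ring_scope.

(* R^n is 'rV[R]_n; as for tuples in the library, its sigma-algebra is the one
   generated by the coordinates, i.e. the Borel sets. *)
Section measurable_rV.
Context {R : realType} {n : nat}.

Definition rV_coord (i : 'I_n) (x : 'rV[R]_n) : measurableTypeR R := x 0 i.

Let rV_set0 : g_sigma_preimage rV_coord set0.
Proof. exact: sigma_algebra0. Qed.

Let rV_setC A : g_sigma_preimage rV_coord A ->
  g_sigma_preimage rV_coord (~` A).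
Proof. exact: sigma_algebraC. Qed.

Let rV_bigcup (F : (set 'rV[R]_n)^nat) :
  (forall i, g_sigma_preimage rV_coord (F i)) ->
  g_sigma_preimage rV_coord (\bigcup_i (F i)).
Proof. exact: sigma_algebra_bigcup. Qed.

HB.instance Definition _ :=
  @isMeasurable.Build default_measure_display 'rV[R]_n
  (g_sigma_preimage rV_coord) rV_set0 rV_setC rV_bigcup.

Lemma measurable_rV_coord (i : 'I_n) : measurable_fun [set: 'rV[R]_n] (rV_coord i).
Proof.
move=> _ Y mY; rewrite setTI; apply: sub_sigma_algebra => /=.
rewrite -bigcup_seq/=; exists i => /=; first by rewrite mem_index_enum.
by exists Y => //; rewrite setTI.
Qed.

Lemma measurable_fun_rVP d (T : measurableType d) (f : T -> 'rV[R]_n) :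
  (forall i, measurable_fun [set: T] (rV_coord i \o f)) ->
  measurable_fun [set: T] f.
Proof.
move=> mf _ A mA; rewrite setTI.
pose G : set (set 'rV[R]_n) := [set B | measurable (f @^-1` B)].
suff : g_sigma_preimage rV_coord `<=` G by exact.
apply: smallest_sub.
  split; rewrite /G /=.
  - by rewrite preimage_set0.
  - by move=> B mB; rewrite setTD preimage_setC; exact: measurableC.
  - by move=> F mF; rewrite preimage_bigcup; exact: bigcupT_measurable.
rewrite -bigcup_seq; apply: bigcup_sub => i _ B [Y mY <-].
by rewrite /G/= setTI -comp_preimage -[X in measurable X]setTI; exact: mf.
Qed.

End measurable_rV.

Section lebesgue_rV.
Context {R : realType}.

Definition rV_cons n (p : measurableTypeR R * 'rV[R]_n) : 'rV[R]_n.+1 :=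
  row_mx (p.1)%:M p.2.

Lemma rV_cons0 n p : @rV_cons n p 0 ord0 = p.1.
Proof.
rewrite (_ : ord0 = lshift n (0 : 'I_1)); last exact/val_inj.
by apply: etrans (row_mxEl _ _ _ _) _; rewrite mxE eqxx mulr1n.
Qed.

Lemma rV_consS n p j : @rV_cons n p 0 (lift ord0 j) = p.2 0 j.
Proof.
rewrite (_ : lift ord0 j = rshift 1 j); last exact/val_inj.
exact: row_mxEr.
Qed.

Lemma measurable_rV_cons n : measurable_fun setT (@rV_cons n).
Proof.
apply: measurable_fun_rVP => i; have [j ->|->] := unliftP ord0 i.
  rewrite (_ : _ \o _ = rV_coord j \o snd).
    by apply: measurableT_comp => //; exact: measurable_rV_coord.
  by apply/funext => p; exact: rV_consS.
by rewrite (_ : _ \o _ = fst)//; apply/funext => p; exact: rV_cons0.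
Qed.

Section lebesgue_rVS.
Context n (mu : {sigma_finite_measure set 'rV[R]_n -> \bar R}).

Definition lebesgue_rVS : set 'rV[R]_n.+1 -> \bar R :=
  pushforward (lebesgue_measure \x mu)%E (@rV_cons n).

Let measurable_preimage (A : set 'rV[R]_n.+1) :
  measurable A -> measurable (@rV_cons n @^-1` A).
Proof.
by move=> mA; rewrite -[X in measurable X]setTI; exact: measurable_rV_cons.
Qed.

Let lebesgue_rVS0 : lebesgue_rVS set0 = 0%E.
Proof. by rewrite /lebesgue_rVS /pushforward preimage_set0 measure0. Qed.

Let lebesgue_rVS_ge0 A : (0 <= lebesgue_rVS A)%E.
Proof. by rewrite /lebesgue_rVS /pushforward; exact: (measure_ge0 (lebesgue_measure \x mu)%E). Qed.

Let lebesgue_rVS_sigma_additive : semi_sigma_additive lebesgue_rVS.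
Proof.
move=> F mF tF mUF; rewrite /lebesgue_rVS /pushforward preimage_bigcup.
apply: measure_semi_sigma_additive.
- by move=> k; exact: measurable_preimage.
- apply/trivIsetP => /= i j _ _ ij; rewrite -preimage_setI.
  by move/trivIsetP : tF => /(_ _ _ _ _ ij) ->//; rewrite preimage_set0.
- by rewrite -preimage_bigcup; exact: measurable_preimage.
Qed.

HB.instance Definition _ := isMeasure.Build _ _ _ lebesgue_rVS
  lebesgue_rVS0 lebesgue_rVS_ge0 lebesgue_rVS_sigma_additive.

Let rV_tail : 'rV[R]_n.+1 -> measurableTypeR R * 'rV[R]_n :=
  fun x => (x 0 0, \row_j x 0 (lift ord0 j)).

Let rV_consK : cancel (@rV_cons n) rV_tail.
Proof.
move=> [a x]; congr pair; first exact: rV_cons0.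
by apply/rowP => j; rewrite mxE rV_consS.
Qed.

Let measurable_rV_tail : measurable_fun setT rV_tail.
Proof.
apply/measurable_fun_pairP; split; first exact: (measurable_rV_coord ord0).
apply: measurable_fun_rVP => i.
rewrite (_ : _ \o _ = rV_coord (lift ord0 i)); first exact: measurable_rV_coord.
by apply/funext => x; rewrite /rV_coord /= mxE.
Qed.

Let lebesgue_rVS_sigma_finite : sigma_finite setT lebesgue_rVS.
Proof.
have /sigma_finiteP[F [TF ndF Foo]] := sigma_finiteT (@lebesgue_measure R).
have /sigma_finiteP[G [TG ndG Goo]] := sigma_finiteT mu.
exists (fun k => rV_tail @^-1` (F k `*` G k)).
  rewrite -preimage_bigcup (_ : \bigcup_k _ = setT) ?preimage_setT//.
  rewrite -subTset => -[x y] _.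
  have [k _ Fkx] : (\bigcup_k F k) x by rewrite -TF.
  have [l _ Gly] : (\bigcup_k G k) y by rewrite -TG.
  exists (maxn k l) => //; split => /=.
  - by move: x Fkx; exact/subsetPset/ndF/leq_maxl.
  - by move: y Gly; exact/subsetPset/ndG/leq_maxr.
move=> k; have [mF Fk] := Foo k; have [mG Gk] := Goo k; split.
  rewrite -[X in measurable X]setTI.
  by apply: measurable_rV_tail => //; exact: measurableX.
rewrite /lebesgue_rVS /pushforward -comp_preimage.
rewrite (_ : _ \o _ = id); last by apply/funext => p /=; rewrite rV_consK.
by rewrite preimage_id product_measure1E// lte_mul_pinfty// ge0_fin_numE.
Qed.

HB.instance Definition _ := Measure_isSigmaFinite.Build _ _ _ lebesgue_rVS
  lebesgue_rVS_sigma_finite.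

End lebesgue_rVS.

Fixpoint lebesgue_rV n : {sigma_finite_measure set 'rV[R]_n -> \bar R} :=
  if n is n'.+1 then lebesgue_rVS (lebesgue_rV n') else dirac (0 : 'rV[R]_0).

End lebesgue_rV.

Section geometry.
Context {R : realType} {n : nat}.
Implicit Types (x y v : 'rV[R]_n) (A K : set 'rV[R]_n).

Definition dot x y : R := (x *m y^T) 0 0.

Definition convex_body K : Prop :=
  [/\ compact K, convex_set (K : set (convex_lmodType 'rV[R]_n))
    & K° !=set0].

Definition vol A : \bar R := lebesgue_rV n A.

Definition perp v : set 'rV[R]_n := [set x | dot x v = 0].

Definition perp_proj v x : 'rV[R]_n := x - dot x v *: v.

(* The rows of E form an orthonormal basis of the hyperplane perp v, so that
   c |-> c *m E is a linear isometry of R^(n-1) onto perp v. *)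
Definition is_perp_frame v (E : 'M[R]_(n.-1, n)) : Prop :=
  E *m E^T = 1%:M /\ E *m v^T = 0.

Definition perp_frame v : 'M[R]_(n.-1, n) := xget 0 (is_perp_frame v).

Definition perp_section v A (s : R) : set 'rV[R]_n :=
  [set x' | perp v x' /\ A (x' + s *: v)].

Definition chord_movement v (beta : 'rV[R]_n -> R) K (t : R) : set 'rV[R]_n :=
  [set x + (beta (perp_proj v x) * t) *: v | x in K].

Definition admissible_times v (beta : 'rV[R]_n -> R) K : set R :=
  [set t | convex_set
     (chord_movement v beta K t : set (convex_lmodType 'rV[R]_n))].

Definition polar K : set 'rV[R]_n :=
  [set y | forall x, K x -> dot x y <= 1].

Definition Lp_support (p : R) K y : R :=
  p^-1 * ln ((fine (vol K))^-1 *
             \int[lebesgue_rV n]_(x in K) expR (p * dot x y)).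

(* The integral is taken in \bar R; the case +oo is singled out because
   poweR sends +oo to +oo for negative exponents too. *)
Definition Lp_polar_norm (p : R) K y : R :=
  if (((n.-1)`!%:R^-1)%:E *
      \int[lebesgue_measure]_(r in `[0%R, +oo[)
         (r ^+ n.-1 * expR (- Lp_support p K (r *: y)))%R%:E)%E
    is a%:E then a `^ (- n%:R^-1) else 0.

(* Only used for 0 < p. *)
Definition Lp_polar (p : \bar R) K : set 'rV[R]_n :=
  match p with
  | p%:E => [set y | Lp_polar_norm p K y <= 1]
  | +oo%E => polar K
  | -oo%E => set0
  end.

End geometry.

Lemma perp_frame_subproof (R : realType) n (v : 'rV[R]_n.+1) :
  dot v v = 1 ->
  exists M : 'M[R]_n.+1, M *m M^T = 1%:M /\ row ord0 M = v.
Proof.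
move=> v1; pose e : 'rV[R]_n.+1 := delta_mx 0 0.
have [->|ve] := eqVneq v e.
  by exists 1%:M; rewrite trmx1 mulmx1 rowE mulmx1.
pose u := v - e; pose c := (1 - v 0 0)^-1.
have ee : e *m e^T = 1%:M by rewrite trmx_delta mul_delta_mx; apply/matrixP=> i j; rewrite !mxE !ord1.
have vv : v *m v^T = 1%:M.
  by apply/matrixP => i j; rewrite !ord1 [LHS]v1 mxE.
have ve' : v *m e^T = (v 0 0)%:M.
  by rewrite trmx_delta -colE; apply/matrixP => i j; rewrite !ord1 !mxE.
have ev : e *m v^T = (v 0 0)%:M.
  by rewrite -[LHS]trmxK trmx_mul trmxK ve' tr_scalar_mx.
have uu : u *m u^T = ((1 - v 0 0) *+ 2)%:M.
  rewrite /u linearB/= mulmxBl !mulmxBr vv ee ve' ev.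
  by rewrite -!(raddfB (@scalar_mx R 1))/=; congr _%:M; rewrite mulr2n opprB.
have eu : e *m u^T = (v 0 0 - 1)%:M.
  by rewrite /u linearB/= mulmxBr ev ee raddfB.
have d0 : 1 - v 0 0 != 0.
  apply: contra ve => /eqP d0; rewrite -subr_eq0 -/u.
  have : \sum_i u 0 i ^+ 2 = (u *m u^T) 0 0.
    by rewrite [RHS]mxE; apply: eq_bigr => i _; rewrite [u^T _ _]mxE.
  rewrite uu d0 mul0rn raddf0 [RHS]mxE => /eqP.
  rewrite psumr_eq0 => [/allP h|i _]; last exact: sqr_ge0.
  apply/eqP/rowP => i; rewrite [RHS]mxE.
  by apply/eqP; rewrite -sqrf_eq0; exact: h (mem_index_enum _).
pose M : 'M[R]_n.+1 := 1%:M - c *: (u^T *m u).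
have MT : M^T = M.
  by rewrite /M linearB/= trmx1 linearZ/= trmx_mul trmxK.
have PP : (u^T *m u) *m (u^T *m u) = ((1 - v 0 0) *+ 2) *: (u^T *m u).
  by rewrite mulmxA -(mulmxA u^T u) uu mul_mx_scalar -scalemxAl.
exists M; split.
  rewrite MT /M; set P := u^T *m u in PP *.
  rewrite mulmxBl !mulmxBr mul1mx mulmx1 mul1mx -scalemxAl -scalemxAr PP.
  rewrite !scalerA -mulrA mulrnAr mulVf// mulr_natr mulr2n scalerDl.
  by rewrite opprB addrK subrK.
rewrite rowE -/e /M mulmxBr mulmx1 -scalemxAr mulmxA eu mul_scalar_mx scalerA.
by rewrite -(opprB 1) mulrN mulVf// scaleN1r opprK /u addrC subrK.
Qed.

Lemma perp_frameP (R : realType) n (v : 'rV[R]_n) :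
  dot v v = 1 -> is_perp_frame v (perp_frame v).
Proof.
case: n v => [|n] v v1.
  by move: v1; rewrite /dot mxE big_ord0 => /esym/eqP; rewrite oner_eq0.
have [M [MM Mv]] := perp_frame_subproof v1.
apply: xgetPex; exists (row' ord0 M); split; apply/matrixP => i j.
  transitivity ((M *m M^T) (lift ord0 i) (lift ord0 j)).
    by rewrite !mxE; apply: eq_bigr => k _; rewrite !mxE.
  by rewrite MM !mxE (inj_eq lift_inj).
transitivity ((M *m M^T) (lift ord0 i) ord0).
  by rewrite -Mv !mxE; apply: eq_bigr => k _; rewrite !mxE.
by rewrite MM !mxE.
Qed.

Section perp_volume.
Context {R : realType} {n : nat}.

(* (n-1)-dimensional volume of the part of A lying in perp v, computed in the
   coordinates of an orthonormal basis of perp v; it does not depend on the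
   choice of the basis because Lebesgue measure is invariant under isometries. *)
Definition perp_vol (v : 'rV[R]_n) (A : set 'rV[R]_n) : \bar R :=
  lebesgue_rV n.-1 [set c | A (c *m perp_frame v)].

End perp_volume.

(* Main.v *)
Require Import Defs.
From HB Require Import structures.
From mathcomp Require Import all_boot all_order all_algebra.
From mathcomp Require Import all_classical all_reals all_analysis.
From mathcomp Require Import measurable_realfun ring lra.

Set Implicit Arguments.
Unset Strict Implicit.
Unset Printing Implicit Defensive.

Import Order.TTheory GRing.Theory Num.Theory.
Import numFieldNormedType.Exports.

Local Open Scope classical_set_scope.
Local Open Scope ring_scope.

(* Let S be the shear x |-> x + t beta(x | v^perp) v, which maps K onto K_t and
   preserves volume. Pulled back by S, the integral defining h_{p,K_t}(y) becomes
   the integral over K of exp (p (<x, y> + t beta(x | v^perp) <v, y>)), whose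
   exponent is affine in (y, t) as long as <v, y> = s is fixed. By Hölder,
     h_{p,K_t}(r y) <= l h_{p,K_t1}(r1 y1) + (1 - l) h_{p,K_t2}(r2 y2)
   where (y, t) is the midpoint of (y1, t1) and (y2, t2), r is the harmonic mean
   of r1 and r2, and l = r2 / (r1 + r2). Ball's transport argument turns this
   into: if the radial integrals at (y1, t1) and (y2, t2) are at least (n-1)!,
   so is the one at (y, t). Hence half the Minkowski sum of the sections at t1
   and t2 lies in the section at the midpoint, and the Brunn-Minkowski inequality
   in dimension n - 1 concludes. *)

(** * Lebesgue measure on the line *)

(** The harmonic mean is forced by the exponent: it is the r with r / 2 = l r1 = (1 - l) r2, so that
    r y and r t split into the data of the two times with the same weights. Membership in a polar
    body enters only as the lower bound (n-1)! on an integral in the extended reals, a form that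
    also covers divergent integrals. For p = +oo there is no integral: the two inequalities that
    define the polar bodies are averaged for each x in K. Minkowski sums need not be measurable, so
    the sumset inequalities speak of any measurable set containing them. Volume on R^n is built one
    coordinate at a time, hence the inductions over fibers. Suprema and total masses that may not be
    attained are replaced by a fraction t < 1 of them, and t then tends to 1. *)

Definition pushforward_measure d1 d2 (T1 : measurableType d1)
    (T2 : measurableType d2) (R : realType) (m : {measure set T1 -> \bar R})
    (f : T1 -> T2) (mf : measurable_fun setT f) : {measure set T2 -> \bar R} :=
  measure_function_pushforward__canonical__measure_function_Measure m mf.

Lemma measurable_addr (R : realType) (c : R) :
  measurable_fun setT (fun x : measurableTypeR R => x + c : measurableTypeR R).
Proof. exact: measurable_funD. Qed.

(** Both sides are measures in [A] that agree on half-open intervals, which determines Lebesgue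
    measure. *)
Lemma lebesgue_measure_shift (R : realType) (c : R) (A : set R) :
  measurable (A : set (measurableTypeR R)) ->
  lebesgue_measure [set x | A (x + c)] = lebesgue_measure A.
Proof.
move=> mA; pose f : measurableTypeR R -> measurableTypeR R := fun x => x + c.
have mf : measurable_fun setT f by exact: measurable_addr.
rewrite -[LHS]/(pushforward_measure lebesgue_measure mf A).
apply/esym/lebesgue_measure_unique => //= _ [[a b]] _ <-.
rewrite /pushforward (_ : f @^-1` `]a, b] = `]a - c, b - c]%classic).
  by rewrite !lebesgue_measure_itv/= !lte_fin ltrD2r -!EFinD opprB addrA subrK.
by apply/seteqP; split => x /=; rewrite !in_itv/= /f ltrBlDr lerBrDr.
Qed.

Lemma lebesgue_measure_dilate (R : realType) (k : R) (A : set R) : 0 < k ->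
  measurable (A : set (measurableTypeR R)) ->
  (k%:E * lebesgue_measure [set x | A (k * x)%R] = lebesgue_measure A)%E.
Proof.
move=> k0 mA; pose f : measurableTypeR R -> measurableTypeR R := fun x => k * x.
have mf : measurable_fun setT f by exact: measurable_funM.
rewrite -[LHS]/(mscale (NngNum (ltW k0))
  (pushforward_measure lebesgue_measure mf) A).
apply/esym/lebesgue_measure_unique => //= _ [[a b]] _ <-.
rewrite /mscale/= /pushforward (_ : f @^-1` `]a, b] = `]a / k, b / k]%classic).
  rewrite !lebesgue_measure_itv/= !lte_fin ltr_pM2r ?invr_gt0//.
  case: ifPn => _; last by rewrite mule0.
  by rewrite -!EFinD -EFinM mulrBr ![k * (_ / _)]mulrC !divfK// gt_eqF.
by apply/seteqP; split => x /=; rewrite !in_itv/= /f ltr_pdivrMr// ler_pdivlMr// mulrC.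
Qed.

Lemma ge0_integral_shift (R : realType) (c : R) (f : R -> \bar R) :
  measurable_fun setT (f : measurableTypeR R -> \bar R) ->
  (forall x, 0 <= f x)%E ->
  (\int[lebesgue_measure]_x f (x + c)%R = \int[lebesgue_measure]_x f x)%E.
Proof.
move=> mf f0; pose g : measurableTypeR R -> measurableTypeR R := fun x => x + c.
have mg : measurable_fun setT g by exact: measurable_addr.
transitivity (\int[pushforward_measure lebesgue_measure mg]_x f x)%E.
  by rewrite ge0_integral_pushforward//= preimage_setT.
by apply: eq_measure_integral => A mA _; exact: lebesgue_measure_shift.
Qed.

Lemma ge0_integral_dilate (R : realType) (k : R) (f : R -> \bar R) : 0 < k ->
  measurable_fun setT (f : measurableTypeR R -> \bar R) ->
  (forall x, 0 <= f x)%E ->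
  (k%:E * \int[lebesgue_measure]_x f (k * x)%R = \int[lebesgue_measure]_x f x)%E.
Proof.
move=> k0 mf f0; pose g : measurableTypeR R -> measurableTypeR R := fun x => k * x.
have mg : measurable_fun setT g by exact: measurable_funM.
transitivity (\int[mscale (NngNum (ltW k0)) (pushforward_measure lebesgue_measure mg)]_x
  f x)%E.
  by rewrite ge0_integral_mscale//= ge0_integral_pushforward//= preimage_setT.
by apply: eq_measure_integral => A mA _; exact: lebesgue_measure_dilate.
Qed.

(** * The sumset inequality on the line *)

Section sumset.
Context {R : realType}.
Implicit Types A B C : set R.
Local Notation mu := (@lebesgue_measure R).
Local Notation meas := (@measurable _ (measurableTypeR R)).

Let compact_measurable' A : compact A -> meas A.
Proof. exact: compact_measurable. Qed.

Lemma lebesgue_measure_le_shift c A C : meas A -> meas C ->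
  (forall x, A x -> C (x + c)) -> (mu A <= mu C)%E.
Proof.
move=> mA mC AC; rewrite -(lebesgue_measure_shift (- c) mA).
apply: le_measure; rewrite ?inE//.
  by rewrite -[X in measurable X]setTI; exact: measurable_addr.
by move=> x /= /AC; rewrite subrK.
Qed.

(* Translate K by the least point of L and L by the greatest point of K: the
   two copies lie in K + L and only meet at one point. *)
Let compact_sumset K L C : compact K -> compact L -> meas C ->
    K !=set0 -> L !=set0 ->
  (forall x y, K x -> L y -> C (x + y)) -> (mu K + mu L <= mu C)%E.
Proof.
move=> cK cL mC K0 L0 KLC.
have idc (A : set R) : {within A, continuous idfun}.
  by apply: continuous_subspaceT => x; exact: cvg_id.
have [a /set_mem Ka aK] := compact_EVT_max K0 cK (idc K).
have [b /set_mem Lb bL] := compact_EVT_min L0 cL (idc L).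
have mK := compact_measurable' cK; have mL := compact_measurable' cL.
have mKa : meas (K `\ a) by exact: measurableD.
have -> : mu K = mu (K `\ a).
  rewrite -[in LHS](setDUK (_ : [set a] `<=` K)); last by move=> _ ->.
  rewrite measureU//=; last first.
    by apply/seteqP; split => x//= [-> []].
  by rewrite lebesgue_measure_set1 add0e.
rewrite -(lebesgue_measure_shift (- b) mKa) -(lebesgue_measure_shift (- a) mL).
have m1 : meas [set x | (K `\ a) (x - b)].
  by rewrite -[X in measurable X]setTI; exact: measurable_addr.
have m2 : meas [set x | L (x - a)].
  by rewrite -[X in measurable X]setTI; exact: measurable_addr.
rewrite -measureU//; last first.
  apply/seteqP; split => // x /= [[/mem_set Kx xa] /mem_set Lx].
  have /= := aK _ Kx; have /= := bL _ Lx => h1 h2.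
  by apply: xa; apply/eqP; rewrite eq_le h2/=; lra.
apply: le_measure; rewrite ?inE//; first exact: measurableU.
move=> x /= [[/KLC /(_ Lb)]|]; first by rewrite subrK.
by move=> /(KLC _ _ Ka); rewrite subrKC.
Qed.

(** Inner regularity reduces this to compact sets, one factor at a time. Nonemptiness puts a
    translate of each set inside [C]. *)
Lemma lebesgue_measure_sumset A B C : meas A -> meas B -> meas C ->
    A !=set0 -> B !=set0 ->
  (forall x y, A x -> B y -> C (x + y)) -> (mu A + mu B <= mu C)%E.
Proof.
move=> mA mB mC [a Aa] [b Bb] ABC.
have BC : (mu B <= mu C)%E.
  by apply: (@lebesgue_measure_le_shift a) => // x Bx; rewrite addrC; exact: ABC.
have AC : (mu A <= mu C)%E.
  by apply: (@lebesgue_measure_le_shift b) => // x Ax; exact: ABC.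
(* An infinite [mu C] leaves nothing to prove; a finite one bounds the other measures, which makes
   the subtractions below legitimate. *)
have [/eqP Coo|Cfin] := eqVneq (mu C) +oo%E.
  by move/eqP : Coo => ->; rewrite leey.
have fin (D : set R) : (mu D <= mu C)%E -> mu D \is a fin_num.
  by move=> DC; rewrite ge0_fin_numE// (le_lt_trans DC)// ltey.
have KL K L : compact K -> compact L -> K `<=` A -> L `<=` B ->
    (mu K + mu L <= mu C)%E.
  move=> cK cL KA LB.
  have mK := compact_measurable' cK; have mL := compact_measurable' cL.
  have [->|/set0P K0] := eqVneq K set0.
    by rewrite measure0 add0e (le_trans _ BC)// le_measure ?inE.
  have [->|/set0P L0] := eqVneq L set0.
    by rewrite measure0 adde0 (le_trans _ AC)// le_measure ?inE.
  by apply: compact_sumset => // x y /KA + /LB; exact: ABC.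
have KB K : compact K -> K `<=` A -> (mu K + mu B <= mu C)%E.
  move=> cK KA; have mK := compact_measurable' cK.
  have fK : mu K \is a fin_num by apply/fin/(le_trans _ AC); rewrite le_measure ?inE.
  rewrite addeC -leeBrDr// (lebesgue_regularity_inner_sup mB).
  by apply: ge_ereal_sup => _ [L [cL LB] <-]; rewrite leeBrDr// addeC KL.
rewrite -leeBrDr ?fin// (lebesgue_regularity_inner_sup mA).
by apply: ge_ereal_sup => _ [K [cK KA] <-]; rewrite leeBrDr ?fin// KB.
Qed.

End sumset.

(** Tonelli for the region [0 < r <= f x], sliced in both directions. Since [f] is at most 1, higher
    levels contribute nothing. *)
Lemma layer_cake (R : realType) (f : R -> R) :
    measurable_fun setT (f : measurableTypeR R -> measurableTypeR R) ->
    (forall x, 0 <= f x <= 1) ->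
  (\int[lebesgue_measure]_x (f x)%:E =
   \int[lebesgue_measure]_(r in `]0%R, 1%R]) lebesgue_measure [set x | (r <= f x)%R])%E.
Proof.
move=> mf f01.
pose S : set (measurableTypeR R * measurableTypeR R) :=
  [set p | (0 < p.2 <= 1) && (p.2 <= f p.1)].
have mS : measurable S.
  pose b (p : measurableTypeR R * measurableTypeR R) :=
    (0 < p.2) && ((p.2 <= 1) && (p.2 <= f p.1)).
  have mb : measurable_fun setT b.
    apply: measurable_and; first exact: measurable_fun_ltr.
    apply: measurable_and; first exact: measurable_fun_ler.
    by apply: measurable_fun_ler => //; exact: measurableT_comp.
  have := mb measurableT [set true] I; rewrite setTI.
  by congr measurable; apply/seteqP; split => p /=; rewrite /S /b /= andbA.
pose k p : \bar R := (\1_S p)%:E.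
have mk : measurable_fun setT k by exact/measurable_EFinP/measurable_indic.
transitivity (\int[lebesgue_measure]_x \int[lebesgue_measure]_r k (x, r))%E.
  apply: eq_integral => x _; rewrite /k.
  have -> : (fun r => (\1_S (x, r))%:E : \bar R) =
      EFin \o (\1_(`]0, f x]%classic : set R) : R -> R).
    apply/funext => r /=; rewrite !indicE; congr ((nat_of_bool _)%:R%:E).
    apply/idP/idP; rewrite !inE /S /= in_itv/=.
      by move=> /andP[/andP[-> _] ->].
    move=> /andP[r0 rf]; rewrite r0 rf (le_trans rf)//.
    by have /andP[] := f01 x.
  have /andP[f0 _] := f01 x.
  rewrite integral_indic//= setIT lebesgue_measure_itv/= lte_fin.
  by have [//|] := ltP; [rewrite oppr0 addr0|move=> h; congr EFin; apply/eqP; rewrite eq_le f0 h].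
rewrite (fubini_tonelli k)//; last by move=> p; rewrite lee_fin.
rewrite [RHS]integral_mkcond; apply: eq_integral => r _; rewrite patchE.
case: ifPn => [/set_mem|/negP]; rewrite ?inE /= in_itv/= => r01.
  have -> : (fun x => k (x, r)) = EFin \o (\1_[set x | r <= f x] : R -> R).
    apply/funext => x /=; rewrite /k !indicE; congr ((nat_of_bool _)%:R%:E).
    by apply/idP/idP; rewrite !inE /S /= r01.
  rewrite integral_indic ?setIT//.
  have mb : measurable_fun setT (fun x : measurableTypeR R => r <= f x).
    exact: measurable_fun_ler.
  by have := mb measurableT [set true] I; rewrite setTI.
apply: integral0_eq => x _; rewrite /k indicE memNset// /S/= => /andP[? _].
exact: r01.
Qed.

(** The sumset inequality holds at each level and the layer cake formula integrates it. Both
    functions reach the common maximum 1, so no superlevel set is empty for [r <= 1]; with an empty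
    one the sumset inequality could fail. *)
Lemma integral_level_sumset (R : realType) (f g h : R -> R) :
    measurable_fun setT (f : measurableTypeR R -> measurableTypeR R) ->
    measurable_fun setT (g : measurableTypeR R -> measurableTypeR R) ->
    measurable_fun setT (h : measurableTypeR R -> measurableTypeR R) ->
    (forall x, 0 <= f x <= 1) -> (forall x, 0 <= g x <= 1) ->
    (forall x, 0 <= h x <= 1) ->
    (exists x, f x = 1) -> (exists x, g x = 1) ->
    (forall r x y, 0 < r <= 1 -> r <= f x -> r <= g y -> r <= h (x + y)) ->
  (\int[lebesgue_measure]_x (f x)%:E + \int[lebesgue_measure]_x (g x)%:E <=
   \int[lebesgue_measure]_x (h x)%:E)%E.
Proof.
move=> mf mg mh f01 g01 h01 [x fx] [y gy] fgh.
rewrite !layer_cake//.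
have mlev (u : R -> R) : measurable_fun setT (u : measurableTypeR R -> measurableTypeR R) ->
    forall r, measurable ([set x | r <= u x] : set (measurableTypeR R)).
  move=> mu r.
  have mb : measurable_fun setT (fun x : measurableTypeR R => r <= u x).
    exact: measurable_fun_ler.
  by have := mb measurableT [set true] I; rewrite setTI.
have mlebN (u : R -> R) : measurable_fun setT (u : measurableTypeR R -> measurableTypeR R) ->
    measurable_fun setT
      ((fun r => lebesgue_measure [set x | r <= u x]) : measurableTypeR R -> \bar R).
  move=> mu.
  pose S : set (measurableTypeR R * measurableTypeR R) := [set p | p.1 <= u p.2].
  have mS : measurable S.
    have mb : measurable_fun setT (fun p : measurableTypeR R * measurableTypeR R => p.1 <= u p.2).
      by apply: measurable_fun_ler => //; exact: measurableT_comp.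
    by have := mb measurableT [set true] I; rewrite setTI.
  have := measurable_fun_xsection (@lebesgue_measure R) mS.
  congr measurable_fun; apply/funext => r /=; congr lebesgue_measure.
  by apply/seteqP; split => z /=; rewrite xsectionE.
have mleb (u : R -> R)
    (mu : measurable_fun setT (u : measurableTypeR R -> measurableTypeR R)) :
    measurable_fun (`]0%R, 1%R]%classic : set (measurableTypeR R))
    ((fun r => lebesgue_measure [set x | r <= u x]) : measurableTypeR R -> \bar R).
  by apply: measurable_funS (mlebN u mu).
rewrite -ge0_integralD//=; try exact: mleb.
apply: ge0_le_integral => //=; try exact: mleb.
  by move=> r _; rewrite adde_ge0.
  by apply: emeasurable_funD; exact: mleb.
move=> r; rewrite in_itv/= => r01; have /andP[r0 r1] := r01.
apply: lebesgue_measure_sumset; try exact: mlev.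
- by exists x; rewrite /= fx.
- by exists y; rewrite /= gy.
- by move=> a b /=; exact: fgh.
Qed.

(** The function [u ^+ d.+1 / w ^+ d] is homogeneous and convex. It lies above its tangent at slope
    [z = (a + b) / (p + q)]; these tangents are linear in [(u, w)] and add up to the exact value at
    [(a + b, p + q)]. *)
Lemma radon_ineq (R : realFieldType) (d : nat) (a b p q : R) :
  0 <= a -> 0 <= b -> 0 < p -> 0 < q ->
  (a + b) ^+ d.+1 / (p + q) ^+ d <= a ^+ d.+1 / p ^+ d + b ^+ d.+1 / q ^+ d.
Proof.
move=> a0 b0 p0 q0.
have tangent (x z : R) : 0 <= x -> 0 <= z ->
    d.+1%:R * x * z ^+ d <= x ^+ d.+1 + d%:R * z ^+ d.+1.
  move=> x0 z0; elim: d => [|d IH]; first by rewrite !mul1r mulr1 mul0r addr0.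
  (* The two factors have the same sign. This product is what the inductive step adds to [z] times
     the previous inequality. *)
  have sg : 0 <= (x - z) * (x ^+ d.+1 - z ^+ d.+1).
    have [xz|zx] := leP x z.
      by rewrite mulr_le0// subr_le0// lerXn2r.
    by rewrite mulr_ge0// subr_ge0 ?lerXn2r// ltW.
  move: (ler_wpM2r z0 IH); rewrite !exprS -!natr1 in sg *; nra.
pose z := (a + b) / (p + q); have pq0 : 0 < p + q by rewrite addr_gt0.
have z0 : 0 <= z by rewrite divr_ge0// ?addr_ge0// ltW.
have term (u w : R) : 0 <= u -> 0 < w ->
    d.+1%:R * u * z ^+ d - d%:R * w * z ^+ d.+1 <= u ^+ d.+1 / w ^+ d.
  move=> u0 w0; have := tangent (u / w) z (divr_ge0 u0 (ltW w0)) z0.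
  move/(ler_wpM2l (ltW w0)).
  have wn : w != 0 by rewrite gt_eqF.
  have -> : w * (d.+1%:R * (u / w) * z ^+ d) = d.+1%:R * u * z ^+ d by field.
  have -> : w * ((u / w) ^+ d.+1 + d%:R * z ^+ d.+1) =
      u ^+ d.+1 / w ^+ d + d%:R * w * z ^+ d.+1.
    rewrite expr_div_n [w ^+ d.+1]exprS.
    by field; rewrite wn expf_neq0.
  by rewrite lerBlDr.
apply: le_trans (lerD (term a p a0 p0) (term b q b0 q0)).
have zE : z * (p + q) = a + b by rewrite /z divfK// gt_eqF.
have -> : (a + b) ^+ d.+1 / (p + q) ^+ d = z ^+ d * (a + b).
  by rewrite /z expr_div_n exprSr; field; rewrite expf_neq0// gt_eqF.
rewrite exprS -natr1 -zE; nra.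
Qed.

(** * The Brunn-Minkowski inequality *)

Lemma rV_cons_D (R : realType) n (x x' : R) (y y' : 'rV[R]_n) :
  rV_cons (x + x', y + y') = rV_cons (x, y) + rV_cons (x', y').
Proof.
apply/rowP => i; rewrite [RHS]mxE; have [j ->|->] := unliftP ord0 i.
  by rewrite !rV_consS [LHS]mxE.
by rewrite !rV_cons0.
Qed.

Lemma rV_cons_Z (R : realType) n (k x : R) (y : 'rV[R]_n) :
  rV_cons (k * x, k *: y) = k *: rV_cons (x, y).
Proof.
apply/rowP => i; rewrite [RHS]mxE; have [j ->|->] := unliftP ord0 i.
  by rewrite !rV_consS [LHS]mxE.
by rewrite !rV_cons0.
Qed.

Definition rV_behead (R : realType) n (x : 'rV[R]_n.+1) : 'rV[R]_n :=
  \row_j x 0 (lift ord0 j).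

Lemma rV_cons_behead (R : realType) n (x : 'rV[R]_n.+1) :
  rV_cons (x 0 0, rV_behead x) = x.
Proof.
apply/rowP => i; have [j ->|->] := unliftP ord0 i.
  by rewrite rV_consS mxE.
by rewrite rV_cons0.
Qed.

Lemma measurable_rV_cons_snd (R : realType) n (x : R) :
  measurable_fun setT (fun y : 'rV[R]_n => rV_cons (x, y)).
Proof. by apply: measurableT_comp; [exact: measurable_rV_cons|exact: pair1_measurable]. Qed.

Definition rV_fiber (R : realType) n (A : set 'rV[R]_n.+1) (x : R) : set 'rV[R]_n :=
  [set y | A (rV_cons (x, y))].

Section fiber.
Context {R : realType} {n : nat}.
Implicit Types A : set 'rV[R]_n.+1.

Lemma measurable_rV_fiber A x : measurable A -> measurable (rV_fiber A x).
Proof.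
move=> mA; rewrite -[X in measurable X]setTI.
exact: (measurable_rV_cons_snd x).
Qed.

Let xsectionE' A x : xsection (@rV_cons R n @^-1` A) x = rV_fiber A x.
Proof. by apply/seteqP; split => y; rewrite /rV_fiber /= xsectionE. Qed.

Lemma lebesgue_rVSE A :
  lebesgue_rV n.+1 A = (\int[lebesgue_measure]_x lebesgue_rV n (rV_fiber A x))%E.
Proof. by apply: eq_integral => x _; rewrite -xsectionE'. Qed.

Lemma measurable_fun_rV_fiber A : measurable A ->
  measurable_fun setT
    ((fun x => lebesgue_rV n (rV_fiber A x)) : measurableTypeR R -> \bar R).
Proof.
move=> mA.
have mA' : measurable (@rV_cons R n @^-1` A).
  by rewrite -[X in measurable X]setTI; exact: measurable_rV_cons.
have := measurable_fun_xsection (lebesgue_rV n) mA'.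
by congr measurable_fun; apply/funext => x /=; rewrite xsectionE'.
Qed.

Lemma ge0_integral_rVS (f : 'rV[R]_n.+1 -> \bar R) :
  measurable_fun setT f -> (forall x, 0 <= f x)%E ->
  (\int[lebesgue_rV n.+1]_x f x =
   \int[lebesgue_measure]_x \int[lebesgue_rV n]_y f (rV_cons (x, y)))%E.
Proof.
move=> mf f0.
have mf' : measurable_fun setT (f \o @rV_cons R n).
  by apply: measurableT_comp => //; exact: measurable_rV_cons.
rewrite -(fubini_tonelli1 (f \o @rV_cons R n))//; last by move=> p; exact: f0.
rewrite -[LHS]/(\int[pushforward (lebesgue_measure \x lebesgue_rV n)%E (@rV_cons R n)]_x f x)%E.
rewrite ge0_integral_pushforward ?preimage_setT//.
exact: measurable_rV_cons.
Qed.

End fiber.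

Lemma rV0_eq (R : realType) (x y : 'rV[R]_0) : x = y.
Proof. by rewrite [x]thinmx0 [y]thinmx0. Qed.

Lemma lebesgue_rV0 (R : realType) (A : set 'rV[R]_0) :
  A !=set0 -> lebesgue_rV 0 A = 1%E.
Proof.
by move=> [x Ax]; rewrite /= diracE mem_set// (rV0_eq 0 x).
Qed.

(** An inequality suits sumsets, where [C] merely contains a translate of [A]; used with [c] and
    with [- c] it yields translation invariance. *)
Lemma lebesgue_rV_le_shift (R : realType) n (c : 'rV[R]_n) (A C : set 'rV[R]_n) :
  measurable A -> measurable C -> (forall x, A x -> C (x + c)) ->
  (lebesgue_rV n A <= lebesgue_rV n C)%E.
Proof.
elim: n c A C => [|n IH] c A C mA mC AC.
  have [->|/set0P[x Ax]] := eqVneq A set0; first by rewrite measure0.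
  by rewrite !lebesgue_rV0//; [exists (x + c); exact: AC|exists x].
rewrite !lebesgue_rVSE.
rewrite -(ge0_integral_shift (c 0 0) (f := fun x => lebesgue_rV n (rV_fiber C x)))//; last first.
  exact: measurable_fun_rV_fiber.
apply: ge0_le_integral => //=; first exact: measurable_fun_rV_fiber.
  apply: (measurableT_comp (measurable_fun_rV_fiber mC)).
  exact: measurable_addr.
move=> x _; apply: (IH (rV_behead c)); try exact: measurable_rV_fiber.
by move=> y /AC; rewrite /rV_fiber /= rV_cons_D rV_cons_behead.
Qed.

Lemma root_exists (R : realType) n (s : R) : (0 < n)%N -> 0 < s ->
  exists2 r, 0 < r & r ^+ n = s.
Proof.
move=> n0 s0; exists (s `^ n%:R^-1); first exact: powR_gt0.
rewrite -powR_mulrn ?powR_ge0// -powRrM mulVf ?powRr1 ?ltW//.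
by rewrite pnatr_eq0 -lt0n.
Qed.

Section truncation.
Context {R : realType}.
Local Notation mu := (@lebesgue_measure R).
Local Open Scope ereal_scope.

(** Monotone convergence of the truncations. The bound on [c] is strict because the integral itself
    may be approached without being reached. *)
Lemma integral_mine_nat (f : R -> \bar R) (c : R) :
    measurable_fun setT (f : measurableTypeR R -> \bar R) ->
    (forall x, 0 <= f x) -> c%:E < \int[mu]_x f x ->
  exists k : nat, c%:E <= \int[mu]_x mine (f x) k.+1%:R%:E.
Proof.
move=> mf f0 cf.
have nd x : {homo (fun k : nat => mine (f x) k.+1%:R%:E) : i j / (i <= j)%N >-> i <= j}.
  by move=> i j ij; rewrite le_min2// lee_fin ler_nat.
have lim x : limn (fun k : nat => mine (f x) k.+1%:R%:E) = f x.
  apply/cvg_lim => //.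
  suff E : f x = ereal_sup (range (fun k : nat => mine (f x) k.+1%:R%:E)).
    by rewrite [X in _ --> X]E; exact: ereal_nondecreasing_cvgn.
  apply/eqP; rewrite eq_le; apply/andP; split; last first.
    by apply: ge_ereal_sup => _ [k _ <-]; rewrite ge_min lexx.
  have := f0 x; case fx : (f x) => [r| |]// r0.
    apply: ereal_sup_ubound; exists (Num.trunc r) => //.
    by apply/min_idPl; rewrite lee_fin ltW// truncnS_gt.
  rewrite leye_eq; apply/eqP/eq_infty => t.
  apply: le_trans (ereal_sup_ubound _); last by exists (Num.trunc t).
  by rewrite /= min_r ?leey// lee_fin ltW// truncnS_gt.
have := @monotone_convergence _ _ R mu setT measurableT
  (fun k x => mine (f x) k.+1%:R%:E).
under [X in X = _]eq_integral do rewrite lim.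
move=> E; rewrite E in cf => //; last 2 first.
- by move=> k; exact: measurable_mine.
- by move=> k x _; rewrite le_min f0/= lee_fin.
have [|//|k _ /(_ k)/= h] := lte_lim _ _ cf.
- move=> i j ij; apply: ge0_le_integral => //=.
  + by move=> x _; rewrite le_min f0/= lee_fin.
  + exact: measurable_mine.
  + exact: measurable_mine.
  + by move=> x _; exact: nd.
- apply: ereal_nondecreasing_is_cvgn => i j ij; apply: ge0_le_integral => //=.
  + by move=> x _; rewrite le_min f0/= lee_fin.
  + exact: measurable_mine.
  + exact: measurable_mine.
  + by move=> x _; exact: nd.
- by exists k; apply: h => /=.
Qed.

(* If f is bounded, truncating it at t times its supremum keeps the fraction
   t of its integral; otherwise truncate at a large level. *)
Lemma integral_mine_attained (f : R -> \bar R) (c t : R) :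
    measurable_fun setT (f : measurableTypeR R -> \bar R) ->
    (forall x, 0 <= f x) -> (0 < c)%R -> c%:E <= \int[mu]_x f x ->
    (0 < t < 1)%R ->
  exists m : R, [/\ (0 < m)%R, (exists x, m%:E <= f x) &
    (t * c)%:E <= \int[mu]_x mine (f x) m%:E].
Proof.
move=> mf f0 c0 cf /andP[t0 t1].
pose S := ereal_sup (range f).
have fS x : f x <= S by apply: ereal_sup_ubound; exists x.
have S0 : 0 < S.
  rewrite ltNge; apply/negP => S0; move: cf; rewrite integral0_eq ?lee_fin ?leNgt ?c0//.
  by move=> x _; apply/eqP; rewrite eq_le f0 (le_trans (fS x)).
have adh r : r%:E < S -> exists x, r%:E <= f x.
  by move=> /ereal_sup_gt[_ [x _ <-] /ltW]; exists x.
case SE : S S0 adh fS => [s| |]// s0 adh fS.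
  rewrite lte_fin in s0.
  exists (t * s)%R; split; first by rewrite mulr_gt0.
    by apply: adh; rewrite lte_fin gtr_pMl.
  rewrite EFinM; apply: (le_trans (lee_wpmul2l _ cf)); first by rewrite lee_fin ltW.
  rewrite -ge0_integralZl_EFin//; last exact: ltW.
  apply: ge0_le_integral => //=.
  - by move=> x _; rewrite mule_ge0// lee_fin ltW.
  - exact: measurable_funeM.
  - exact: measurable_mine.
  - move=> x _; rewrite le_min; apply/andP; split.
      by rewrite gee_pMl// ?lee_fin 1?ltW// ge0_fin_numE// (le_lt_trans (fS x))// ltry.
    by rewrite EFinM lee_wpmul2l// lee_fin ltW.
have [//|k kf] := @integral_mine_nat f (t * c)%R mf f0.
  by rewrite (lt_le_trans _ cf)// lte_fin gtr_pMl.
by exists k.+1%:R; split => //; apply: adh; rewrite ltry.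
Qed.

End truncation.

Lemma lee_fin_scale (R : realType) (c : R) (y : \bar R) : 0 <= c ->
  (forall t, 0 < t < 1 -> ((t * c)%:E <= y)%E) -> (c%:E <= y)%E.
Proof.
move=> c0 tcy; rewrite leNgt; apply/negP => yc.
(* The factor 1/2 alone gives [c / 2 <= y < c]: so [y] is finite and [c] positive, which makes the
   next factor admissible. *)
have : (((2^-1 * c)%:E : \bar R) <= y)%E by apply: tcy; lra.
case: y tcy yc => [y| |]// tcy; rewrite lte_fin lee_fin => yc hc.
have c1 : 0 < c by lra.
(* Chosen so that [t * c] is the midpoint of [y] and [c], hence exceeds [y]. *)
pose t := (c + y) / (2 * c).
have tc : t * c = (c + y) / 2 by rewrite /t; field; rewrite gt_eqF.
have : ((t * c)%:E <= y%:E)%E.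
  apply: tcy; rewrite /t divr_gt0 ?ltr_pdivrMr ?mulr_gt0//; lra.
rewrite lee_fin tc; lra.
Qed.

Lemma lee_weighted_sum (R : realType) (p q r a b : R) (x y z : \bar R) :
    0 < p -> 0 < q -> 0 < r -> (a%:E <= x)%E -> (b%:E <= y)%E ->
    (p^-1%:E * x + q^-1%:E * y <= r^-1%:E * z)%E ->
  ((r * (p^-1 * a + q^-1 * b))%:E <= z)%E.
Proof.
move=> p0 q0 r0 ax by_ xyz; rewrite EFinM -lee_pdivlMl//.
apply: le_trans xyz; rewrite EFinD; apply: leeD.
  by rewrite EFinM lee_wpmul2l// lee_fin invr_ge0 ltW.
by rewrite EFinM lee_wpmul2l// lee_fin invr_ge0 ltW.
Qed.

(* Truncate the fiber volumes of A and B at levels p ^ n and q ^ n that they attain,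
   and rescale them to have maximum 1. The level sets of the rescaled functions add
   up inside those of C rescaled by (p + q) ^ n, so the one-dimensional inequality
   applies to them; Radon's inequality then eliminates p and q. *)
Lemma brunn_minkowski_step (R : realType) n (A B C : set 'rV[R]_n.+1) (a b : R) :
    measurable A -> measurable B -> measurable C ->
    (forall s p q x y, 0 < s <= 1 -> 0 < p -> 0 < q ->
      ((s * p ^+ n)%:E <= lebesgue_rV n (rV_fiber A x))%E ->
      ((s * q ^+ n)%:E <= lebesgue_rV n (rV_fiber B y))%E ->
      ((s * (p + q) ^+ n)%:E <= lebesgue_rV n (rV_fiber C (x + y)))%E) ->
  0 < a -> 0 < b ->
  ((a ^+ n.+1)%:E <= lebesgue_rV n.+1 A)%E ->
  ((b ^+ n.+1)%:E <= lebesgue_rV n.+1 B)%E ->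
  (((a + b) ^+ n.+1)%:E <= lebesgue_rV n.+1 C)%E.
Proof.
move=> mA mB mC ABC a0 b0; rewrite !lebesgue_rVSE => aA bB.
set fA := (fun x => lebesgue_rV n (rV_fiber A x)) in ABC aA *.
set fB := (fun x => lebesgue_rV n (rV_fiber B x)) in ABC bB *.
set fC := (fun x => lebesgue_rV n (rV_fiber C x)) in ABC *.
have [mfA mfB mfC] : [/\ measurable_fun setT (fA : measurableTypeR R -> \bar R),
    measurable_fun setT (fB : measurableTypeR R -> \bar R) &
    measurable_fun setT (fC : measurableTypeR R -> \bar R)].
  by split; exact: measurable_fun_rV_fiber.
apply: lee_fin_scale => [|t t01]; first by rewrite exprn_ge0// addr_ge0 ?ltW.
have level (f : R -> \bar R) c : measurable_fun setT (f : measurableTypeR R -> \bar R) ->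
    (forall x, 0 <= f x)%E -> 0 < c ->
    (n = 0%N -> forall x, (0 < f x)%E -> f x = 1%E) ->
    ((c ^+ n.+1)%:E <= \int[lebesgue_measure]_x f x)%E ->
    exists m : R, [/\ 0 < m, (exists x, ((m ^+ n)%:E <= f x)%E) &
     ((t * c ^+ n.+1)%:E <= \int[lebesgue_measure]_x mine (f x) (m ^+ n)%:E)%E].
  move=> mf f0 c0 nf cf.
  have [] := integral_mine_attained mf f0 _ cf t01; first exact: exprn_gt0.
  move=> s [s0 [x sx] st]; have [n0|n0] := posnP n; last first.
    by have [m m0 ms] := root_exists n0 s0; exists m; rewrite ms; split => //; exists x.
  (* For [n = 0] every level [m ^+ n] is 1 and cannot be tuned. Fibers then have volume 0 or 1, so
     the attained level satisfies [s <= f x = 1] and may be raised to 1. *)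
  have fx : f x = 1%E by apply: nf => //; rewrite (lt_le_trans _ sx)// lte_fin.
  exists 1; rewrite expr1n; split => //; first by exists x; rewrite fx.
  apply: le_trans st _; apply: ge0_le_integral => //=.
  - by move=> y _; rewrite le_min f0 lee_fin ltW.
  - exact: measurable_mine.
  - exact: measurable_mine.
  - by move=> y _; rewrite le_min2// -fx.
have val1 (D : R -> set 'rV[R]_n) : n = 0%N -> forall x, (0 < lebesgue_rV n (D x))%E ->
    lebesgue_rV n (D x) = 1%E.
  move: D; rewrite -/fA; case: (n) => // D _ x Dx; apply: lebesgue_rV0.
  by apply/set0P; apply: contraTneq Dx => ->; rewrite measure0 ltxx.
have [p [p0 [xA pA] pint]] := level _ _ mfA (fun=> measure_ge0 _ _) a0 (val1 _) aA.
have [q [q0 [xB qB] qint]] := level _ _ mfB (fun=> measure_ge0 _ _) b0 (val1 _) bB.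
have pn0 : 0 < p ^+ n by exact: exprn_gt0.
have qn0 : 0 < q ^+ n by exact: exprn_gt0.
have pq0 : 0 < (p + q) ^+ n by rewrite exprn_gt0// addr_gt0.
pose tr (f : R -> \bar R) (c : R) x := fine (mine (f x) c%:E) / c.
have trE f c x : 0 < c -> (0 <= f x)%E ->
    ((tr f c x)%:E = (c^-1)%:E * mine (f x) c%:E)%E.
  move=> c0 f0; rewrite /tr mulrC EFinM fineK// ge0_fin_numE ?le_min ?f0 ?lee_fin ?ltW//.
  by rewrite gt_min ltry orbT.
have tr01 f c : 0 < c -> (forall x, 0 <= f x)%E -> forall x, 0 <= tr f c x <= 1.
  move=> c0 f0 x; rewrite -!lee_fin trE//; apply/andP; split.
    by apply: mule_ge0; rewrite ?le_min ?f0 lee_fin ?invr_ge0 ltW.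
  rewrite lee_pdivrMl// mule1 ge_min lexx orbT//.
(* Up to height 1 the truncation is invisible: level [r] of the rescaled function is level [r * c]
   of the fiber volumes, where [ABC] applies. *)
have le_tr f c r x : 0 < c -> (0 <= f x)%E -> r <= 1 ->
    (r <= tr f c x) = ((r * c)%:E <= f x)%E.
  move=> c0 f0 r1; rewrite -lee_fin trE// lee_pdivlMl// -EFinM mulrC le_min.
  by rewrite andb_idr// => _; rewrite lee_fin ger_pMl.
have mtr f c : 0 < c -> (forall x, 0 <= f x)%E ->
    measurable_fun setT (f : measurableTypeR R -> \bar R) ->
    measurable_fun setT (tr f c : measurableTypeR R -> measurableTypeR R).
  move=> c0 f0 mf; apply/measurable_EFinP.
  rewrite (_ : _ \o _ = fun x => (c^-1)%:E * mine (f x) c%:E)%E; last first.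
    by apply/funext => x /=; rewrite trE.
  by apply: measurable_funeM; exact: measurable_mine.
have itr f c : 0 < c -> (forall x, 0 <= f x)%E ->
    measurable_fun setT (f : measurableTypeR R -> \bar R) ->
    (\int[lebesgue_measure]_x (tr f c x)%:E =
     (c^-1)%:E * \int[lebesgue_measure]_x mine (f x) c%:E)%E.
  move=> c0 f0 mf; under eq_integral do rewrite trE//.
  rewrite ge0_integralZl_EFin//.
  - by move=> x _; rewrite le_min f0 lee_fin ltW.
  - exact: measurable_mine.
  - by rewrite invr_ge0 ltW.
have A0 x : (0 <= fA x)%E by exact: measure_ge0.
have B0 x : (0 <= fB x)%E by exact: measure_ge0.
have C0 x : (0 <= fC x)%E by exact: measure_ge0.
have := @integral_level_sumset R (tr fA (p ^+ n)) (tr fB (q ^+ n)) (tr fC ((p + q) ^+ n)).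
move=> /(_ (mtr _ _ pn0 A0 mfA) (mtr _ _ qn0 B0 mfB) (mtr _ _ pq0 C0 mfC)).
move=> /(_ (tr01 _ _ pn0 A0) (tr01 _ _ qn0 B0) (tr01 _ _ pq0 C0)).
have tr1 f c x : 0 < c -> (forall x, 0 <= f x)%E -> (c%:E <= f x)%E -> tr f c x = 1.
  move=> c0 f0 cf; apply/eqP; rewrite eq_le le_tr// mul1r cf andbT.
  by have /andP[] := tr01 f c c0 f0 x.
move=> /(_ (ex_intro _ xA (tr1 _ _ _ pn0 A0 pA)) (ex_intro _ xB (tr1 _ _ _ qn0 B0 qB))).
have lev r x y : 0 < r <= 1 -> r <= tr fA (p ^+ n) x -> r <= tr fB (q ^+ n) y ->
    r <= tr fC ((p + q) ^+ n) (x + y).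
  by move=> r01; have /andP[_ r1] := r01; rewrite !le_tr//; exact: ABC.
move=> /(_ lev); rewrite !itr//.
have CC : (\int[lebesgue_measure]_x mine (fC x) ((p + q) ^+ n)%:E <=
    \int[lebesgue_measure]_x fC x)%E.
  apply: ge0_le_integral => //=.
  - by move=> x _; rewrite le_min C0 lee_fin ltW.
  - exact: measurable_mine.
  - by move=> x _; rewrite ge_min lexx.
move=> /(lee_weighted_sum pn0 qn0 pq0 pint qint) /le_trans/(_ CC).
apply: le_trans; rewrite lee_fin.
have /andP[t0 t1] := t01.
have := radon_ineq n (ltW a0) (ltW b0) p0 q0.
rewrite ler_pdivrMr// => /(ler_wpM2l (ltW t0)) => /le_trans; apply.
rewrite le_eqVlt; apply/orP; left; apply/eqP; field.
by rewrite !gt_eqF.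
Qed.

(* Bounds a ^ n <= |A| in place of n-th roots make sense for infinite volumes,
   and for n = 0. *)
Theorem brunn_minkowski_rV (R : realType) n (A B C : set 'rV[R]_n) (a b : R) :
    measurable A -> measurable B -> measurable C -> A !=set0 -> B !=set0 ->
    (forall x y, A x -> B y -> C (x + y)) -> 0 <= a -> 0 <= b ->
    ((a ^+ n)%:E <= lebesgue_rV n A)%E -> ((b ^+ n)%:E <= lebesgue_rV n B)%E ->
  (((a + b) ^+ n)%:E <= lebesgue_rV n C)%E.
Proof.
elim: n A B C a b => [|n IH] A B C a b mA mB mC [x0 Ax0] [y0 By0] ABC a0 b0 aA bB.
  by rewrite expr0 lebesgue_rV0//; exists (x0 + y0); exact: ABC.
(* The dimension step needs positive [a] and [b]; if one of them is 0, a translate of the other set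
   inside [C] suffices. *)
have [a00|an0] := eqVneq a 0.
  rewrite a00 add0r; apply: le_trans bB _; apply: (lebesgue_rV_le_shift mB mC (c := x0)).
  by move=> y By; rewrite addrC; exact: ABC.
have [b00|bn0] := eqVneq b 0.
  rewrite b00 addr0; apply: le_trans aA _; apply: (lebesgue_rV_le_shift mA mC (c := y0)).
  by move=> x Ax; exact: ABC.
have {an0 bn0}[a_gt0 b_gt0] : 0 < a /\ 0 < b by rewrite !lt_def an0 bn0.
apply: brunn_minkowski_step aA bB => // s p q x y /andP[s0 s1] p0 q0 pA qB.
have ne (D : set 'rV[R]_n) (r : R) : 0 < r -> (r%:E <= lebesgue_rV n D)%E -> D !=set0.
  move=> r0 rD; apply/set0P; apply: contraTneq rD => ->.
  by rewrite measure0 lee_fin -ltNge.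
have nA : rV_fiber A x !=set0 by apply: ne pA; rewrite mulr_gt0// exprn_gt0.
have nB : rV_fiber B y !=set0 by apply: ne qB; rewrite mulr_gt0// exprn_gt0.
have fABC z w : rV_fiber A x z -> rV_fiber B y w -> rV_fiber C (x + y) (z + w).
  by move=> Az Bw; rewrite /rV_fiber/= rV_cons_D; exact: ABC.
have [n0|n0] := posnP n.
  apply: (@le_trans _ _ 1%E); first by rewrite n0 expr0 mulr1 lee_fin.
  have [z Az] := nA; have [w Bw] := nB.
  have : rV_fiber C (x + y) !=set0 by exists (z + w); exact: fABC.
  by move: (rV_fiber C (x + y)); rewrite n0 => D D0; rewrite lebesgue_rV0.
(* Writing [s] as [r ^+ n] turns [s * p ^+ n] into [(r * p) ^+ n], the form of the induction
   hypothesis. Dimension 0 was set apart because it offers no such root. *)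
have [r r0 rs] := root_exists n0 s0.
move: pA qB; rewrite -rs -!exprMn => pA qB; rewrite mulrDr.
apply: IH pA qB => //; try exact: measurable_rV_fiber.
- by rewrite mulr_ge0// ltW.
- by rewrite mulr_ge0// ltW.
Qed.

(** * Translations, dilations and shears *)

Section measurable_rV_ops.
Context d (T : measurableType d) (R : realType) (n : nat).
Implicit Types f g : T -> 'rV[R]_n.

Lemma measurable_fun_rV_entry f i : measurable_fun setT f ->
  measurable_fun setT ((fun x => f x 0 i) : T -> measurableTypeR R).
Proof. by move=> mf; apply: (measurableT_comp (measurable_rV_coord i)). Qed.

Lemma measurable_fun_rVD f g : measurable_fun setT f -> measurable_fun setT g ->
  measurable_fun setT (fun x => f x + g x).
Proof.
move=> mf mg; apply: measurable_fun_rVP => i.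
rewrite (_ : _ \o _ = fun x => f x 0 i + g x 0 i).
  by apply: measurable_funD; exact: measurable_fun_rV_entry.
by apply/funext => x; rewrite /rV_coord /= mxE.
Qed.

Lemma measurable_fun_rVZ (r : T -> measurableTypeR R) f :
  measurable_fun setT r -> measurable_fun setT f ->
  measurable_fun setT (fun x => (r x : R) *: f x).
Proof.
move=> mr mf; apply: measurable_fun_rVP => i.
rewrite (_ : _ \o _ = fun x => r x * f x 0 i).
  by apply: measurable_funM => //; exact: measurable_fun_rV_entry.
by apply/funext => x; rewrite /rV_coord /= mxE.
Qed.

Lemma dotE (x y : 'rV[R]_n) : dot x y = \sum_i x 0 i * y 0 i.
Proof. by rewrite /dot mxE; apply: eq_bigr => i _; rewrite mxE. Qed.

Lemma measurable_fun_dot f g : measurable_fun setT f -> measurable_fun setT g ->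
  measurable_fun setT ((fun x => dot (f x) (g x)) : T -> measurableTypeR R).
Proof.
move=> mf mg; rewrite (_ : (fun _ => _) = fun x => \sum_i f x 0 i * g x 0 i).
  by apply: measurable_sum => i; apply: measurable_funM; exact: measurable_fun_rV_entry.
by apply/funext => x; exact: dotE.
Qed.

End measurable_rV_ops.

Section rV_invariance.
Context {R : realType}.

Lemma measurable_rV_translate n (c : 'rV[R]_n) :
  measurable_fun setT (fun x : 'rV[R]_n => x + c).
Proof.
by apply: (@measurable_fun_rVD _ _ R n (fun x => x) (fun=> c)) => //; exact: measurable_id.
Qed.

Lemma measurable_rV_scale n (k : R) :
  measurable_fun setT (fun x : 'rV[R]_n => k *: x).
Proof.
by apply: (@measurable_fun_rVZ _ _ R n (fun=> k) (fun x => x)) => //; exact: measurable_id.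
Qed.

Lemma lebesgue_rV_shift n (c : 'rV[R]_n) (A : set 'rV[R]_n) : measurable A ->
  lebesgue_rV n [set x | A (x + c)] = lebesgue_rV n A.
Proof.
move=> mA; have mA' : measurable [set x | A (x + c)].
  rewrite -[X in measurable X]setTI.
  exact: (measurable_rV_translate c).
apply/eqP; rewrite eq_le; apply/andP; split.
  exact: (lebesgue_rV_le_shift mA' mA (c := c)).
apply: (lebesgue_rV_le_shift mA mA' (c := - c)) => x Ax /=.
by rewrite subrK.
Qed.

Lemma lebesgue_rV_dilate n (k : R) (A : set 'rV[R]_n) : 0 < k -> measurable A ->
  ((k ^+ n)%:E * lebesgue_rV n [set x | A (k *: x)] = lebesgue_rV n A)%E.
Proof.
move=> k0; elim: n A => [|n IH] A mA.
  rewrite expr0 mul1e (_ : [set x | _] = A)//.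
  by apply/seteqP; split => x; rewrite /= (rV0_eq (k *: x) x).
have mphi := measurable_fun_rV_fiber mA.
rewrite !lebesgue_rVSE -[RHS](ge0_integral_dilate k0)//.
rewrite exprS EFinM -muleA; congr (_ * _)%E.
rewrite -ge0_integralZl_EFin//; first last.
- by rewrite exprn_ge0// ltW.
- apply: measurable_fun_rV_fiber; rewrite -[X in measurable X]setTI.
  exact: (measurable_rV_scale k).
apply: eq_integral => x _; rewrite -(IH _ (measurable_rV_fiber (k * x) mA)).
congr (_ * lebesgue_rV n _)%E.
by apply/seteqP; split => y; rewrite /rV_fiber /= rV_cons_Z.
Qed.

Lemma ge0_integral_rV_shift n (c : 'rV[R]_n) (f : 'rV[R]_n -> \bar R) :
    measurable_fun setT f -> (forall x, 0 <= f x)%E ->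
  (\int[lebesgue_rV n]_x f (x + c)%R = \int[lebesgue_rV n]_x f x)%E.
Proof.
move=> mf f0; have mg : measurable_fun setT (fun x : 'rV[R]_n => x + c).
  exact: (measurable_rV_translate c).
transitivity (\int[pushforward_measure (lebesgue_rV n) mg]_x f x)%E.
  by rewrite ge0_integral_pushforward//= preimage_setT.
by apply: eq_measure_integral => A mA _; exact: lebesgue_rV_shift.
Qed.

(** At fixed first coordinate [r], the coordinate [z] differs from the tail of the point by a
    translation along the tail of [v], so volume is preserved; Tonelli then moves [r] inside. *)
Lemma ge0_integral_rVS_oblique n (v : 'rV[R]_n.+1) (f : 'rV[R]_n.+1 -> \bar R) :
    v 0 0 != 0 -> measurable_fun setT f -> (forall x, 0 <= f x)%E ->
  (\int[lebesgue_rV n.+1]_x f x = \int[lebesgue_rV n]_z \int[lebesgue_measure]_r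
     f (rV_cons (0, z) + (r / v 0 0) *: v)%R)%E.
Proof.
move=> v0 mf f0; rewrite ge0_integral_rVS//.
pose h (p : measurableTypeR R * 'rV[R]_n) := f (rV_cons (0, p.2) + (p.1 / v 0 0) *: v).
have mh : measurable_fun setT h.
  apply: measurableT_comp => //; apply: measurable_fun_rVD.
    apply: measurableT_comp; first exact: measurable_rV_cons.
    exact/measurable_fun_pair.
  apply: measurable_fun_rVZ; last exact: measurable_cst.
  by apply: measurable_funM.
rewrite -(fubini_tonelli h mh (fun p => f0 _)).
apply: eq_integral => r _.
rewrite -(ge0_integral_rV_shift ((r / v 0 0) *: rV_behead v))//; last first.
  by apply: measurableT_comp => //; exact: measurable_rV_cons_snd.
apply: eq_integral => z _; rewrite /h /=; congr f.
have := rV_cons_Z (r / v 0 0) (v 0 0) (rV_behead v).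
by rewrite rV_cons_behead => <-; rewrite -rV_cons_D add0r divfK.
Qed.

(* If v_0 = 0, use the induction hypothesis on each fiber; otherwise, in the oblique
   coordinates (r, z), the shear is a translation of r depending on z only. *)
Lemma ge0_integral_rV_shear n (v : 'rV[R]_n) (g : 'rV[R]_n -> R)
    (f : 'rV[R]_n -> \bar R) :
    measurable_fun setT (g : _ -> measurableTypeR R) ->
    (forall x a, g (x + a *: v) = g x) ->
    measurable_fun setT f -> (forall x, 0 <= f x)%E ->
  (\int[lebesgue_rV n]_x f (x + g x *: v)%R = \int[lebesgue_rV n]_x f x)%E.
Proof.
elim: n v g f => [|n IH] v g f mg gv mf f0.
  by apply: eq_integral => x _; congr f; exact: rV0_eq.
have mF : measurable_fun setT (fun x : 'rV[R]_n.+1 => f (x + g x *: v)).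
  apply: measurableT_comp => //; apply: measurable_fun_rVD => //.
  exact: (measurable_fun_rVZ mg (measurable_cst _)).
have [v0|v0] := eqVneq (v 0 0) 0; last first.
  rewrite (ge0_integral_rVS_oblique v0 mF (fun=> f0 _)) (ge0_integral_rVS_oblique v0 mf f0).
  apply: eq_integral => z _.
  pose h r := f (rV_cons (0, z) + (r / v 0 0) *: v).
  (* The coefficient of [v] is [r / v 0 0], so adding [g] to it amounts to adding [v 0 0 * g] to
     [r]. *)
  rewrite -[RHS](ge0_integral_shift (v 0 0 * g (rV_cons (0, z))) (f := h)); last 2 first.
  - apply: measurableT_comp => //; apply: measurable_fun_rVD; first exact: measurable_cst.
    apply: measurable_fun_rVZ; last exact: measurable_cst.
    by apply: measurable_funM.
  - by move=> r; exact: f0.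
  apply: eq_integral => r _; rewrite /h gv -addrA -scalerDl; congr (f (_ + _ *: _)).
  by field.
have vE a : a *: v = rV_cons (0, a *: rV_behead v).
  by have := rV_cons_Z a (v 0 0) (rV_behead v); rewrite rV_cons_behead v0 mulr0.
rewrite (ge0_integral_rVS mF (fun=> f0 _)) (ge0_integral_rVS mf f0).
apply: eq_integral => r _.
rewrite -(IH (rV_behead v) (fun y => g (rV_cons (r, y))) (fun y => f (rV_cons (r, y)))).
- apply: eq_integral => y _; congr f; by rewrite vE -rV_cons_D addr0.
- by apply: measurableT_comp => //; exact: measurable_rV_cons_snd.
- move=> y a; rewrite -(gv (rV_cons (r, y)) a); congr g.
  by rewrite vE -rV_cons_D addr0.
- by apply: measurableT_comp => //; exact: measurable_rV_cons_snd.
- by move=> y; exact: f0.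
Qed.

End rV_invariance.

(** * Ball's inequality for radial integrals *)

Section ball_lemma.
Context {R : realType}.
Implicit Types F G H f g h : R -> R.

Lemma is_derive_ge0_le F f (x y : R) : x <= y ->
    {in `[x, y], forall z : R, is_derive z 1 F (f z)} ->
    {in `]x, y[, forall z, 0 <= f z} ->
  F x <= F y.
Proof.
rewrite le_eqVlt => /predU1P[->//|xy] dF f0; have [||c cxy E] := @MVT R F f x y xy.
- by move=> z /subset_itv_oo_cc /dF.
- apply: derivable_within_continuous => z /dF dz; exact: ex_derive.
by rewrite -subr_ge0 E mulr_ge0 ?f0// subr_ge0 ltW.
Qed.

Lemma is_derive_gt0_lt F f (x y : R) : x < y ->
    {in `[x, y], forall z : R, is_derive z 1 F (f z)} ->
    {in `]x, y[, forall z, 0 < f z} ->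
  F x < F y.
Proof.
move=> xy dF f0; have [||c cxy E] := @MVT R F f x y xy.
- by move=> z /subset_itv_oo_cc /dF.
- apply: derivable_within_continuous => z /dF dz; exact: ex_derive.
by rewrite -subr_gt0 E mulr_gt0 ?subr_gt0// f0.
Qed.

(* Writing f, g for the densities at x and y, the second factor on the right is the
   derivative in x of the harmonic mean of x and y when dy / dx = f / g. *)
Lemma harmonic_density_le N (x y A B C : R) : 0 < x -> 0 < y ->
    C <= (y * A + x * B) / (x + y) ->
  x ^+ N * expR (- A) <=
  (2 * (x^-1 + y^-1)^-1) ^+ N * expR (- C) *
  ((2 * (x^-1 + y^-1)^-1) ^+ 2 / 2 *
   (x ^- 2 + x ^+ N * expR (- A) / (y ^+ N * expR (- B)) / y ^+ 2)).
Proof.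
move=> x0 y0 CAB; set r := 2 * _; set f := x ^+ N * _; set g := y ^+ N * _.
have xy0 : 0 < x + y by rewrite addr_gt0.
(* These weights give [r = 2 * l * x = 2 * m * y]. Dividing the claim by [f] then leaves 1 <= l
   (2l)^(N+1) e^(A-C) + m (2m)^(N+1) e^(B-C), which is [key]. *)
pose l := y / (x + y); pose m := x / (x + y).
have l0 : 0 < l by rewrite divr_gt0.
have m0 : 0 < m by rewrite divr_gt0.
have lm1 : l + m = 1 by rewrite /l /m; field; rewrite gt_eqF.
have rx : r = 2 * l * x.
  by rewrite /r /l; field; rewrite !gt_eqF// addr_gt0.
have ry : r = 2 * m * y.
  by rewrite /r /m; field; rewrite !gt_eqF// addr_gt0.
have f0 : 0 < f by rewrite mulr_gt0 ?exprn_gt0 ?expR_gt0.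
have g0 : 0 < g by rewrite mulr_gt0 ?exprn_gt0 ?expR_gt0.
(* Added at [2 * l] and [2 * m], these bounds give l ln(2l) + m ln(2m) >= 0: the entropy of (l, m)
   relative to (1/2, 1/2) is nonnegative. *)
have lnb (z : R) : 0 < z -> z - 1 <= z * ln z.
  move=> z0; have := @le_ln1Dx R (z^-1 - 1).
  rewrite subrKC lnV ?posrE// => /(_ _).
  have zi : 0 < z^-1 by rewrite invr_gt0.
  have h : -1 < z^-1 - 1 by lra.
  move=> /(_ h) /(ler_wpM2l (ltW z0)).
  rewrite mulrBr mulfV ?gt_eqF// mulr1 mulrN; lra.
(* By [expR u >= 1 + u] the right side is at least 1 + (l A + m B - C) + (N + 1) times that
   entropy. *)
have key : 1 <= l * expR (A - C + N.+1%:R * ln (2 * l)) +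
                m * expR (B - C + N.+1%:R * ln (2 * m)).
  have e1 := expR_ge1Dx (A - C + N.+1%:R * ln (2 * l)).
  have e2 := expR_ge1Dx (B - C + N.+1%:R * ln (2 * m)).
  have b1 := lnb (2 * l) (mulr_gt0 (ltr0n R 2) l0).
  have b2 := lnb (2 * m) (mulr_gt0 (ltr0n R 2) m0).
  have CAB' : C <= l * A + m * B.
    apply: le_trans CAB _; rewrite le_eqVlt; apply/orP; left; apply/eqP.
    by rewrite /l /m; field; rewrite gt_eqF.
  apply: le_trans (lerD (ler_wpM2l (ltW l0) e1) (ler_wpM2l (ltW m0) e2)).
  have N0 : (0 : R) <= N.+1%:R by [].
  have : 0 <= N.+1%:R * (l * ln (2 * l) + m * ln (2 * m)).
    rewrite mulr_ge0//; lra.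
  have -> : m = 1 - l by rewrite -lm1 addrAC subrr add0r.
  nra.
have expn (z : R) : 0 < z -> expR (N.+1%:R * ln z) = z ^+ N.+1.
  by move=> z0; rewrite expRM_natl lnK.
have lw : 0 < 2 * l by rewrite mulr_gt0.
have mw : 0 < 2 * m by rewrite mulr_gt0.
rewrite !expRD (expn _ lw) (expn _ mw) in key.
rewrite -[leLHS]mulr1; move: key => /(ler_wpM2l (ltW f0)) /le_trans; apply.
rewrite le_eqVlt; apply/orP; left; apply/eqP.
have eA : f * expR A = x ^+ N by rewrite /f -mulrA -expRD addNr expR0 mulr1.
have eB : g * expR B = y ^+ N by rewrite /g -mulrA -expRD addNr expR0 mulr1.
rewrite mulrDr mulrDr [RHS]mulrDr; congr (_ + _).
  transitivity ((f * expR A) * expR (- C) * (2 * l) ^+ N.+1 * l); first by ring.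
  rewrite eA rx [X in _ * X = _](_ : l = (2 * l) / 2); last by field.
  move: (2 * l) => w; rewrite !exprMn exprS; field.
  by rewrite gt_eqF.
have eB' : expR B = y ^+ N / g by rewrite -eB mulrAC mulfV ?gt_eqF// mul1r.
rewrite eB' ry [X in _ * (X * _) = _](_ : m = (2 * m) / 2); last by field.
 move: (2 * m) => w; rewrite !exprMn exprS; field.
by rewrite !gt_eqF.
Qed.

(* Transport: let T r be defined by G (T r) = F r. Along the harmonic mean rho of
   r and T r, H (rho r) grows at least as fast as F r, and starts from 0. *)
Lemma ball_harmonic_mean N (a b c F G H : R -> R) (R1 R2 : R) :
    (forall x y, 0 < x -> 0 < y ->
      c (2 * (x^-1 + y^-1)^-1) <= (y * a x + x * b y) / (x + y)) ->
    (forall x : R, 0 < x -> is_derive x 1 F (x ^+ N * expR (- a x))) ->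
    (forall x : R, 0 < x -> is_derive x 1 G (x ^+ N * expR (- b x))) ->
    (forall x : R, 0 < x -> is_derive x 1 H (x ^+ N * expR (- c x))) ->
    (forall e, 0 < e -> exists2 d, 0 < d & forall x, 0 < x < d -> F x < e) ->
    (forall e, 0 < e -> exists2 d, 0 < d & forall x, 0 < x < d -> G x < e) ->
    (forall x, 0 < x -> 0 < F x) -> (forall x, 0 < x -> 0 < H x) ->
    0 < R1 -> 0 < R2 -> F R1 = G R2 ->
  F R1 <= H (2 * (R1^-1 + R2^-1)^-1).
Proof.
move=> cab dF dG dH F0 G0 Fp Hp R10 R20 FG.
have dens0 x (u : R -> R) : 0 < x -> 0 < x ^+ N * expR (- u x).
  by move=> x0; rewrite mulr_gt0 ?exprn_gt0 ?expR_gt0.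
have Glt x y : 0 < x -> x < y -> G x < G y.
  move=> x0 xy; apply: (is_derive_gt0_lt xy) => z; rewrite in_itv/= => /andP[xz _].
    by apply: dG; exact: lt_le_trans xz.
  by apply: dens0; exact: lt_trans xz.
have Flt x y : 0 < x -> x < y -> F x < F y.
  move=> x0 xy; apply: (is_derive_gt0_lt xy) => z; rewrite in_itv/= => /andP[xz _].
    by apply: dF; exact: lt_le_trans xz.
  by apply: dens0; exact: lt_trans xz.
have Ginj x y : 0 < x -> 0 < y -> G x = G y -> x = y.
  move=> x0 y0 xy; have [xy'|yx'|//] := ltgtP x y.
    by have := Glt _ _ x0 xy'; rewrite xy ltxx.
  by have := Glt _ _ y0 yx'; rewrite xy ltxx.
pose Ginv y := xget 0 [set x | 0 < x /\ G x = y].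
have GK x : 0 < x -> Ginv (G x) = x.
  move=> x0; rewrite /Ginv; case: xgetP => [y -> [y0 /Ginj]|/(_ x)]; first exact.
  by move=> /(_ (conj x0 erefl)).
(* Intermediate value theorem: [G] is below [F r] near 0, and [F r <= F R1 = G R2]. *)
have Gonto r : 0 < r -> r <= R1 -> exists2 s, 0 < s & G s = F r.
  move=> r0 rR1; have [d d0 Gd] := G0 _ (Fp _ r0).
  pose e := Num.min (d / 2) (R2 / 2).
  have e0 : 0 < e by rewrite lt_min !divr_gt0.
  have eR2 : e <= R2 by rewrite ge_min; apply/orP; right; lra.
  have Ge : G e < F r.
    by apply: Gd; rewrite e0/= gt_min; apply/orP; left; lra.
  have FrR2 : F r <= G R2.
    rewrite -FG; move: rR1; rewrite le_eqVlt => /predU1P[->//|/(Flt _ _ r0)/ltW//].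
  have [||s] := @IVT R G e R2 (F r) eR2.
  - apply: derivable_within_continuous => z; rewrite in_itv/= => /andP[ez _].
    have dz := dG z (lt_le_trans e0 ez); exact: ex_derive.
  - rewrite ge_min le_max FrR2 (ltW Ge)/= orbT//.
  by rewrite in_itv/= => /andP[es _] Gs; exists s => //; exact: lt_le_trans es.
pose T r := Ginv (F r).
have T0 r : 0 < r -> r <= R1 -> 0 < T r /\ G (T r) = F r.
  by move=> r0 rR1; have [s s0 Gs] := Gonto r r0 rR1; rewrite /T -Gs GK.
have TR1 : T R1 = R2 by rewrite /T FG GK.
pose f r := r ^+ N * expR (- a r).
pose g r := r ^+ N * expR (- b r).
pose h r := r ^+ N * expR (- c r).
have dT (r : R) : 0 < r -> r <= R1 -> is_derive r 1 T (f r / g (T r)).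
  move=> r0 rR1; have [t0 GT] := T0 r r0 rR1.
  have nearpos : \forall z \near T r, 0 < z by exact: lt_nbhsr.
  have dGi : is_derive (G (T r)) 1 Ginv (g (T r))^-1.
    apply: is_derive_inverse.
    - by near=> z; apply: GK; near: z.
    - near=> z; apply: differentiable_continuous; apply/derivable1_diffP.
      have dz : is_derive z 1 G (g z) by apply: dG; near: z.
      exact: ex_derive.
    - exact: dG.
    - by rewrite gt_eqF// dens0.
  rewrite GT in dGi; have dFr := dF r r0.
  rewrite mulrC; exact: is_derive1_comp.
pose rho r := 2 * (r^-1 + (T r)^-1)^-1.
have rho0 r : 0 < r -> r <= R1 -> 0 < rho r.
  move=> r0 rR1; have [t0 _] := T0 r r0 rR1.
  by rewrite mulr_gt0// invr_gt0 addr_gt0 ?invr_gt0.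
have drho (r : R) : 0 < r -> r <= R1 ->
    is_derive r 1 rho (rho r ^+ 2 / 2 * (r ^- 2 + f r / g (T r) / T r ^+ 2)).
  move=> r0 rR1; have [t0 GT] := T0 r r0 rR1.
  have d1 : is_derive r 1 (fun z : R => z^-1) (- r ^- 2).
    have := @is_deriveV R id r 1 1; rewrite /= => /(_ _ _) d.
    apply: is_derive_eq (d (negbT (gt_eqF r0))) _.
    by rewrite /GRing.scale/= mulr1.
  have d2 := @is_deriveV R T r _ 1 (negbT (gt_eqF t0)) (dT r r0 rR1).
  have d3 := is_deriveD d1 d2.
  have s0 : r^-1 + (T r)^-1 != 0 by rewrite gt_eqF// addr_gt0 ?invr_gt0.
  have d4 := @is_deriveV R _ r _ 1 s0 d3.
  have d5 := is_deriveZ 2 d4.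
  apply: is_derive_eq d5 _.
  rewrite -[LHS]/(2 * (- (r^-1 + (T r)^-1) ^- 2 *
    (- r ^- 2 + - T r ^- 2 * (f r / g (T r))))) /rho.
  move: (f r / g (T r)) => q; field.
  by rewrite !gt_eqF// addr_gt0.
pose W r := H (rho r) - F r.
have dW (r : R) : 0 < r -> r <= R1 -> is_derive r 1 W
    (h (rho r) * (rho r ^+ 2 / 2 * (r ^- 2 + f r / g (T r) / T r ^+ 2)) - f r).
  move=> r0 rR1.
  have dHr := dH _ (rho0 r r0 rR1); have dr := drho r r0 rR1; have dFr := dF r r0.
  apply: is_deriveB; exact: is_derive1_comp.
suff : 0 <= W R1 by rewrite /W /rho TR1 subr_ge0.
(* Transport is available on positive radii only, so the comparison starts at some [x > 0] with
   [F x < e]; there [W x >= - e] because [H] is positive. *)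
apply/ler_addgt0Pr => e e0; have [d d0 Fd] := F0 _ e0.
pose x := Num.min (d / 2) R1.
have x0 : 0 < x by rewrite lt_min divr_gt0.
have xR1 : x <= R1 by rewrite ge_min lexx orbT.
have Fx : F x < e by apply: Fd; rewrite x0/= gt_min; apply/orP; left; lra.
have Wx : - e <= W x.
  have := Hp _ (rho0 x x0 xR1); rewrite /W; lra.
have : W x <= W R1.
  apply: (is_derive_ge0_le xR1) => z; rewrite in_itv/= => /andP[xz zR1].
    by apply: dW => //; exact: lt_le_trans xz.
  have z0 := lt_trans x0 xz; have [t0 _] := T0 z z0 (ltW zR1).
  by rewrite subr_ge0; apply: harmonic_density_le => //; exact: cab.
lra.
Unshelve. all: by end_near.
Qed.

End ball_lemma.

(** * Radial integrals and their primitives *)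

Section radial_integral.
Context {R : realType} (N : nat).
Implicit Types a b c : R -> R.
Local Notation mu := (@lebesgue_measure R).

Definition radial_density a (r : R) : R := r ^+ N * expR (- a r).

Definition radial_primitive a (x : R) : R :=
  (\int[mu]_(t in `[0%R, x]) radial_density a t)%R.

Lemma continuous_radial_density a : continuous a -> continuous (radial_density a).
Proof.
move=> ca x; apply: cvgM; first exact: exprn_continuous.
apply: continuous_comp; last exact: continuous_expR.
by apply: cvgN; exact: ca.
Qed.

Lemma radial_density_ge0 a r : 0 <= r -> 0 <= radial_density a r.
Proof. by move=> r0; rewrite mulr_ge0 ?exprn_ge0 ?expR_ge0. Qed.

Lemma integrable_radial_density a x : continuous a ->
  mu.-integrable `[0, x] (EFin \o radial_density a).
Proof.
move=> ca; apply: continuous_compact_integrable; first exact: segment_compact.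
exact/continuous_subspaceT/continuous_radial_density.
Qed.

Lemma is_derive_radial_primitive a (x : R) : continuous a -> 0 < x ->
  is_derive x 1 (radial_primitive a) (radial_density a x).
Proof.
move=> ca x0.
have cx : {for x, continuous (radial_density a)} by exact: continuous_radial_density.
have [] := @continuous_FTC1_closed R (radial_density a) 0 x (x + 1) _
  (integrable_radial_density (x + 1) ca) x0 cx.
  by rewrite ltrDl.
by move=> dF E; apply: DeriveDef; [exact: dF|rewrite -derive1E; exact: E].
Qed.

Lemma radial_primitive_ge0 a x : 0 <= radial_primitive a x.
Proof.
by apply: Rintegral_ge0 => t; rewrite /= in_itv/= => /andP[t0 _]; exact: radial_density_ge0.
Qed.

Lemma radial_primitive_gt0 a x : continuous a -> 0 < x -> 0 < radial_primitive a x.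
Proof.
move=> ca x0; apply: (le_lt_trans (radial_primitive_ge0 a (x / 2))).
apply: (@is_derive_gt0_lt _ _ (radial_density a)); first lra.
  move=> z; rewrite in_itv/= => /andP[xz _]; apply: is_derive_radial_primitive => //.
  by apply: lt_le_trans xz; lra.
move=> z; rewrite in_itv/= => /andP[xz _].
by rewrite mulr_gt0 ?exprn_gt0 ?expR_gt0//; apply: lt_trans xz; lra.
Qed.

Lemma radial_primitive_near0 a e : continuous a -> 0 < e ->
  exists2 d, 0 < d & forall x, 0 < x < d -> radial_primitive a x < e.
Proof.
move=> ca e0.
have [d /= d0 dP] := @parameterized_integral_near_left R 0 1 e (radial_density a)
  ltr01 e0 (integrable_radial_density 1 ca).
exists d => // x /andP[x0 xd].
have := dP x; rewrite /= sub0r normrN gtr0_norm// => /(_ xd (ltW x0)).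
by apply: le_lt_trans; exact: ler_norm.
Qed.

Lemma radial_primitive_onto a m x : continuous a -> 0 < x -> 0 < m ->
  m <= radial_primitive a x -> exists2 s, 0 < s & radial_primitive a s = m.
Proof.
move=> ca x0 m0 mx; have [d d0 dP] := radial_primitive_near0 ca m0.
pose e := Num.min (d / 2) x.
have e0 : 0 < e by rewrite lt_min divr_gt0.
have ex : e <= x by rewrite ge_min lexx orbT.
have Pe : radial_primitive a e < m.
  by apply: dP; rewrite e0/= gt_min; apply/orP; left; lra.
have [||s] := @IVT R (radial_primitive a) e x m ex.
- apply: derivable_within_continuous => z; rewrite in_itv/= => /andP[ez _].
  have dz := is_derive_radial_primitive ca (lt_le_trans e0 ez); exact: ex_derive.
- by rewrite ge_min le_max mx (ltW Pe)/= orbT.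
by rewrite in_itv/= => /andP[es _] sm; exists s => //; exact: lt_le_trans es.
Qed.

Definition radial_integral a : \bar R :=
  (\int[mu]_(r in `[0%R, +oo[) (radial_density a r)%:E)%E.

Let mdens a : continuous a ->
  measurable_fun setT (radial_density a : measurableTypeR R -> measurableTypeR R).
Proof. by move=> ca; apply: continuous_measurable_fun; exact: continuous_radial_density. Qed.

Lemma EFin_radial_primitive a x : continuous a ->
  (radial_primitive a x)%:E = (\int[mu]_(t in `[0%R, x]) (radial_density a t)%:E)%E.
Proof.
move=> ca; rewrite /radial_primitive /Rintegral fineK//.
exact: integrable_fin_num (integrable_radial_density x ca).
Qed.

Lemma radial_primitive_le a x : continuous a ->
  ((radial_primitive a x)%:E <= radial_integral a)%E.
Proof.
move=> ca; rewrite EFin_radial_primitive//; apply: ge0_subset_integral => //=.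
- by apply/measurable_EFinP; apply: measurable_funS (mdens ca).
- by move=> t; rewrite in_itv/= andbT => t0; rewrite lee_fin radial_density_ge0.
- exact: subset_itvl.
Qed.

Lemma radial_integral_gt0 a : continuous a -> (0 < radial_integral a)%E.
Proof.
move=> ca; apply: lt_le_trans (radial_primitive_le 1 ca).
by rewrite lte_fin radial_primitive_gt0.
Qed.

Lemma radial_primitive_gt a m : continuous a -> (m%:E < radial_integral a)%E ->
  exists2 x, 0 < x & m <= radial_primitive a x.
Proof.
(* The absolute value makes the integrand nonnegative on the whole line even for odd [N], as
   exhausting the half-line by segments requires. *)
move=> ca; pose f r := `|r| ^+ N * expR (- a r).
have fE (i : interval R) : [set` i] `<=` [set` `[0, +oo[] ->
    (\int[mu]_(t in [set` i]) (f t)%:E = \int[mu]_(t in [set` i]) (radial_density a t)%:E)%E.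
  move=> i0; apply: eq_integral => t /set_mem/i0; rewrite /= in_itv/= andbT => t0.
  by rewrite /f ger0_norm.
have f0 x : 0 <= f x by rewrite mulr_ge0 ?exprn_ge0 ?expR_ge0.
have mf : measurable_fun setT (f : measurableTypeR R -> measurableTypeR R).
  apply: measurable_funM; first by apply: measurable_funX; exact: normr_measurable.
  apply: (measurableT_comp (@measurable_expR R)); apply: measurable_funN.
  exact: continuous_measurable_fun.
rewrite /radial_integral -fE// (ge0_integral_ereal_sup mu f0 mf).
move=> /ereal_sup_gt[_ [k _ <-]].
rewrite fE; last by move=> x /=; rewrite !in_itv/= => /andP[->].
by rewrite -EFin_radial_primitive// lte_fin => /ltW; exists k.+1%:R.
Qed.

(** Mass [k] may be reached only at infinity, but mass [t * k] with [t < 1] is reached at finite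
    radii [R1] and [R2]. Ball's argument compares there, and [t] tends to 1. *)
Lemma radial_integral_harmonic_le a b c (k : R) :
    continuous a -> continuous b -> continuous c ->
    (forall x y, 0 < x -> 0 < y ->
      c (2 * (x^-1 + y^-1)^-1) <= (y * a x + x * b y) / (x + y)) ->
    0 < k -> (k%:E <= radial_integral a)%E -> (k%:E <= radial_integral b)%E ->
  (k%:E <= radial_integral c)%E.
Proof.
move=> ca cb cc cab k0 ka kb; apply: lee_fin_scale => [|t /andP[t0 t1]]; first exact: ltW.
have tk0 : 0 < t * k by rewrite mulr_gt0.
have tk : t * k < k by rewrite gtr_pMl.
have att u : continuous u -> (k%:E <= radial_integral u)%E ->
    exists2 s, 0 < s & radial_primitive u s = t * k.
  move=> cu ku; have [|x x0 xk] := @radial_primitive_gt u (t * k) cu.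
    by rewrite (lt_le_trans _ ku)// lte_fin.
  exact: radial_primitive_onto xk.
have [R1 R10 E1] := att a ca ka; have [R2 R20 E2] := att b cb kb.
apply: (le_trans _ (radial_primitive_le (2 * (R1^-1 + R2^-1)^-1) cc)).
rewrite lee_fin -[leLHS]E1.
apply: (@ball_harmonic_mean R N a b c _ (radial_primitive b)).
- exact: cab.
- by move=> x x0; exact: is_derive_radial_primitive.
- by move=> x x0; exact: is_derive_radial_primitive.
- by move=> x x0; exact: is_derive_radial_primitive.
- by move=> e e0; exact: radial_primitive_near0.
- by move=> e e0; exact: radial_primitive_near0.
- by move=> x x0; exact: radial_primitive_gt0.
- by move=> x x0; exact: radial_primitive_gt0.
- exact: R10.
- exact: R20.
- by rewrite E1.
Qed.

End radial_integral.

(** * Lp support functions along a chord movement *)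

Section log_exp_integral.
Context d (T : measurableType d) (R : realType) (mu : {measure set T -> \bar R}).
Context (D : set T) (mD : measurable D) (muD0 : (0 < mu D)%E) (muDoo : (mu D < +oo)%E).
Implicit Types q : T -> R.

Definition mbounded q :=
  measurable_fun D (q : T -> measurableTypeR R) /\
  exists M : R, forall x, D x -> `|q x| <= M.

Definition log_exp_integral q : R := ln (\int[mu]_(x in D) expR (q x)).

Lemma integrable_expR q : mbounded q -> mu.-integrable D (EFin \o (expR \o q)).
Proof.
move=> [mq [M qM]]; apply: measurable_bounded_integrable => //.
  by apply: (measurableT_comp (@measurable_expR R)).
exists (expR M); split; first exact: num_real.
move=> y My x Dx; rewrite /= ger0_norm ?expR_ge0//.
by rewrite (le_trans _ (ltW My))// ler_expR (le_trans (ler_norm _))// qM.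
Qed.

Lemma exp_integral_gt0 q : mbounded q -> 0 < \int[mu]_(x in D) expR (q x).
Proof.
move=> bq; have [mq [M qM]] := bq.
have fin : mu D \is a fin_num by rewrite ge0_fin_numE.
apply: (@lt_le_trans _ _ (\int[mu]_(x in D) expR (- M))).
  by rewrite Rintegral_cst// mulr_gt0 ?expR_gt0// fine_gt0// muD0 muDoo.
apply: le_Rintegral => //.
- by apply: (@integrable_expR (fun=> - M)); split => //; exists `|M| => x _; rewrite normrN.
- exact: integrable_expR.
- by move=> x Dx; rewrite ler_expR lerNl (le_trans _ (qM x Dx))// -normrN ler_norm.
Qed.

(** The integrand grows by a factor of at most [expR e]. This gives the Lipschitz bound on support
    functions along rays. *)
Lemma log_exp_integral_le_add q1 q2 e : mbounded q1 -> mbounded q2 ->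
    (forall x, D x -> q1 x <= q2 x + e) ->
  log_exp_integral q1 <= log_exp_integral q2 + e.
Proof.
move=> b1 b2 q12; rewrite -[e]expRK -lnM ?posrE ?expR_gt0 ?exp_integral_gt0//.
rewrite ler_ln ?posrE ?mulr_gt0 ?expR_gt0 ?exp_integral_gt0//.
rewrite mulrC -RintegralZl//; last exact: integrable_expR.
apply: le_Rintegral => //; first exact: integrable_expR.
  have := integrableZl mD (expR e) (integrable_expR b2).
  by apply: eq_integrable.
by move=> x /q12; rewrite -expRD ler_expR addrC.
Qed.

(* Hölder's inequality, in logarithmic form: after normalizing the two
   integrals to 1 it is the convexity of expR, integrated. *)
Lemma log_exp_integral_convex q1 q2 q3 (l m : R) :
    mbounded q1 -> mbounded q2 -> mbounded q3 -> 0 <= l -> 0 <= m -> l + m = 1 ->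
    (forall x, D x -> q3 x <= l * q1 x + m * q2 x) ->
  log_exp_integral q3 <= l * log_exp_integral q1 + m * log_exp_integral q2.
Proof.
move=> b1 b2 b3 l0 m0 lm1 q123.
set a := log_exp_integral q1; set b := log_exp_integral q2.
(* Obtained from the tangent line of [expR] at [l * u + m * w]. *)
have conv (u w : R) : expR (l * u + m * w) <= l * expR u + m * expR w.
  have e1 := expR_ge1Dx (u - (l * u + m * w)).
  have e2 := expR_ge1Dx (w - (l * u + m * w)).
  have E0 := expR_gt0 (l * u + m * w).
  have E1 : expR u = expR (l * u + m * w) * expR (u - (l * u + m * w)).
    by rewrite -expRD subrKC.
  have E2 : expR w = expR (l * u + m * w) * expR (w - (l * u + m * w)).
    by rewrite -expRD subrKC.
  rewrite E1 E2 (mulrCA l) (mulrCA m) -mulrDr ler_peMr ?expR_ge0//.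
  have := lerD (ler_wpM2l l0 e1) (ler_wpM2l m0 e2); apply: le_trans.
  rewrite le_eqVlt; apply/orP; left; apply/eqP.
  transitivity (l + m + (1 - (l + m)) * (l * u + m * w)); last by ring.
  by rewrite lm1 subrr mul0r addr0.
have ea : expR a = \int[mu]_(x in D) expR (q1 x).
  by rewrite lnK// posrE exp_integral_gt0.
have eb : expR b = \int[mu]_(x in D) expR (q2 x).
  by rewrite lnK// posrE exp_integral_gt0.
rewrite -ler_expR {1}/log_exp_integral lnK ?posrE ?exp_integral_gt0//.
clearbody a b; have [c ce] : exists c, c = l * a + m * b by exists (l * a + m * b).
rewrite -ce.
have i1 : mu.-integrable D (EFin \o (fun x => expR c * l * expR (- a) * expR (q1 x))).
  have := integrableZl mD (expR c * l * expR (- a)) (integrable_expR b1).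
  by apply: eq_integrable.
have i2 : mu.-integrable D (EFin \o (fun x => expR c * m * expR (- b) * expR (q2 x))).
  have := integrableZl mD (expR c * m * expR (- b)) (integrable_expR b2).
  by apply: eq_integrable.
apply: (@le_trans _ _ (\int[mu]_(x in D)
  (expR c * l * expR (- a) * expR (q1 x) + expR c * m * expR (- b) * expR (q2 x)))).
  apply: le_Rintegral => //; first exact: integrable_expR.
    by have := integrableD mD i1 i2; apply: eq_integrable.
  move=> x Dx.
  have -> : expR c * l * expR (- a) * expR (q1 x) + expR c * m * expR (- b) * expR (q2 x) =
      expR c * (l * expR (q1 x - a) + m * expR (q2 x - b)) by rewrite !expRD; ring.
  apply: (@le_trans _ _ (expR c * expR (q3 x - c))).
    by rewrite -expRD subrKC.
  rewrite ler_pM2l ?expR_gt0//; apply: le_trans (conv _ _).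
  rewrite ler_expR lerBlDr (le_trans (q123 x Dx))// ce.
  by rewrite le_eqVlt; apply/orP; left; apply/eqP; ring.
rewrite RintegralD// !RintegralZl//; try exact: integrable_expR.
have na (z : R) : expR (- z) * expR z = 1 by rewrite -expRD addNr expR0.
have cancel (k z : R) : k * expR (- z) * expR z = k by rewrite -mulrA na mulr1.
by rewrite -ea -eb !cancel -mulrDr lm1 mulr1.
Qed.

End log_exp_integral.

(** * Borel sets and continuous functions on R^n *)

Section rV_borel.
Context {R : realType} {n : nat}.
Implicit Types A K : set 'rV[R]_n.

Let rV_box (q : 'rV[rat]_n) (k : nat) : set 'rV[R]_n :=
  [set x | forall i, `|x 0 i - ratr (q 0 i)| < k.+1%:R^-1].

Let measurable_rV_box q k : measurable (rV_box q k).
Proof.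
have -> : rV_box q k = \bigcap_(i in [set: 'I_n])
    [set x : 'rV[R]_n | `|x 0 i - ratr (q 0 i)| < k.+1%:R^-1].
  by apply/seteqP; split => [x h i _|x h i] /=; exact: h.
apply: fin_bigcap_measurable; first exact: finite_finset.
move=> i _.
have mi : measurable_fun setT
    (fun x : 'rV[R]_n => `|x 0 i - ratr (q 0 i)| < k.+1%:R^-1).
  apply: measurable_fun_ltr => //.
  apply: (measurableT_comp (normr_measurable (D := setT))).
  by apply: measurable_funB => //; exact: measurable_rV_coord.
by have := mi measurableT [set true] I; rewrite setTI.
Qed.

(** The sigma-algebra comes from the coordinates, so topology has to be tied to it: an open set is
    the union of the countably many rational cubes that it contains. *)
Lemma open_measurable_rV A : open A -> measurable A.
Proof.
move=> oA.
have -> : A = \bigcup_(p : 'rV[rat]_n * nat)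
    (if `[< rV_box p.1 p.2 `<=` A >] then rV_box p.1 p.2 else set0).
  apply/seteqP; split => [x Ax|x [p _]]; last by case: asboolP => // pA /pA.
  have /nbhs_ballP[e /= e0 eA] : nbhs x A by exact: open_nbhs_nbhs.
  (* With a half-side below [e / 2], any point of a cube containing [x] is within [e] of [x]. *)
  pose k := Num.trunc (2 / e).
  have ke : k.+1%:R^-1 < e / 2.
    rewrite -[e / 2]invrK ltf_pV2 ?posrE ?invr_gt0 ?divr_gt0// invf_div.
    exact: truncnS_gt.
  have k0 : (0 : R) < k.+1%:R^-1 by rewrite invr_gt0.
  have Q i : exists q : rat, `|x 0 i - ratr q| < k.+1%:R^-1.
    have [|q] := @rat_in_itvoo R (x 0 i) (x 0 i + k.+1%:R^-1); first by rewrite ltrDl.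
    rewrite in_itv/= => /andP[q1 q2]; exists q.
    by rewrite distrC ger0_norm ?subr_ge0 1?ltW// ltrBlDl.
  pose q := \row_i sval (cid (Q i)).
  have xq : rV_box q k x by move=> i; rewrite mxE; case: cid.
  exists (q, k) => //=; case: asboolP => // qA; exfalso; apply: qA => y yq.
  apply: eA; split => // i j; rewrite ord1 /ball/=.
  have := yq j; have := xq j; move: (ratr (q 0 j) : R) (k.+1%:R^-1 : R) ke => z r re.
  rewrite !ltr_norml => /andP[? ?] /andP[? ?].
  by apply/andP; split; lra.
apply: countable_bigcupT_measurable => [|p].
  exact: countableP.
by case: asboolP => // _; exact: measurable_rV_box.
Qed.

Lemma closed_measurable_rV A : closed A -> measurable A.
Proof. by move/closed_openC/open_measurable_rV/measurableC; rewrite setCK. Qed.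

Lemma compact_measurable_rV A : compact A -> measurable A.
Proof. by move/(compact_closed (@norm_hausdorff _ _))/closed_measurable_rV. Qed.

(** Continuity is only relative to [K]: preimages of open sets are traces on [K] of open sets, and
    [f] is replaced by 0 elsewhere. *)
Lemma measurable_fun_within_compact K (f : 'rV[R]_n -> R) :
  compact K -> {within K, continuous f} ->
  measurable_fun setT ((f \_ K) : _ -> measurableTypeR R).
Proof.
move=> cK cf.
have mK := compact_measurable_rV cK.
apply/(measurable_restrictT _ mK); apply: (measurability _ (RGenOpens.measurableE R)).
move=> _ [_ [a [b ->] <-]].
have /continuousP/(_ _ (@interval_open R (BRight a) (BLeft b) isT isT)) := cf.
move=> /open_subspaceP[V oV VD]; rewrite setIC -VD.
by apply: measurableI => //; exact: open_measurable_rV.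
Qed.

Lemma dotDl (x y z : 'rV[R]_n) : dot (x + y) z = dot x z + dot y z.
Proof. by rewrite /dot mulmxDl mxE. Qed.

Lemma dotZl a (x y : 'rV[R]_n) : dot (a *: x) y = a * dot x y.
Proof. by rewrite /dot -scalemxAl mxE. Qed.

Lemma dotC (x y : 'rV[R]_n) : dot x y = dot y x.
Proof. by rewrite !dotE; apply: eq_bigr => i _; rewrite mulrC. Qed.

Lemma dotDr (x y z : 'rV[R]_n) : dot z (x + y) = dot z x + dot z y.
Proof. by rewrite dotC dotDl !(dotC z). Qed.

Lemma dotZr a (x y : 'rV[R]_n) : dot y (a *: x) = a * dot y x.
Proof. by rewrite dotC dotZl (dotC y). Qed.

Lemma continuous_dotl (y : 'rV[R]_n) : continuous (fun x => dot x y).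
Proof.
move=> x; rewrite (_ : (fun x => dot x y) = fun x => \sum_i x 0 i * y 0 i).
  apply: (@cvg_big R 'I_n +%R 0 xpredT _ 'rV[R]_n (nbhs x) _
    (fun i (z : 'rV[R]_n) => z 0 i * y 0 i) (fun i => x 0 i * y 0 i)).
    exact: add_continuous.
  move=> i _; apply: cvgM; last exact: cvg_cst.
  exact: coord_continuous.
by apply/funext => z; exact: dotE.
Qed.

Lemma compact_rV_bounded K (f : 'rV[R]_n -> R) :
  compact K -> {within K, continuous f} -> exists M : R, forall x, K x -> `|f x| <= M.
Proof.
move=> cK cf; have := compact_bounded (continuous_compact cf cK).
move=> [M [_ /(_ (M + 1))]]; rewrite ltrDl => /(_ ltr01) h.
by exists (M + 1) => x Kx; apply: h; exists x.
Qed.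

End rV_borel.

(** * Chord movements as measure-preserving shears *)

Section chord_movement_measure.
Context {R : realType} {n : nat}.
Variables (v : 'rV[R]_n) (K : set 'rV[R]_n) (beta : 'rV[R]_n -> R).
Hypotheses (v1 : dot v v = 1) (cK : compact K).
Hypothesis cbeta : {within perp_proj v @` K, continuous beta}.

Lemma perp_projDZ x a : perp_proj v (x + a *: v) = perp_proj v x.
Proof.
by rewrite /perp_proj dotDl dotZl v1 mulr1 scalerDl opprD addrACA subrr addr0.
Qed.

Lemma continuous_perp_proj : continuous (perp_proj v).
Proof.
move=> x; rewrite /perp_proj; apply: (@cvgB _ _ _ (nbhs x) (nbhs_filter x)).
  exact: cvg_id.
by apply: (@cvgZr_tmp _ _ _ (nbhs x) (nbhs_filter x)); exact: continuous_dotl.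
Qed.

Lemma compact_perp_proj : compact (perp_proj v @` K).
Proof.
by apply: continuous_compact => //; apply: continuous_subspaceT; exact: continuous_perp_proj.
Qed.

(** The speed is controlled only on the shadow of [K]. Cut to 0 off it and composed with the
    projection, it becomes measurable on R^n and constant along [v], so the shear is global. *)
Definition chord_speed (x : 'rV[R]_n) : R :=
  (beta \_ (perp_proj v @` K)) (perp_proj v x).

Lemma chord_speedE x : K x -> chord_speed x = beta (perp_proj v x).
Proof. by move=> Kx; rewrite /chord_speed patchE mem_set//; exists x. Qed.

Lemma chord_speedDZ x a : chord_speed (x + a *: v) = chord_speed x.
Proof. by rewrite /chord_speed perp_projDZ. Qed.

Lemma measurable_chord_speed :
  measurable_fun setT (chord_speed : _ -> measurableTypeR R).
Proof.
have mP : measurable_fun setT (perp_proj v).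
  rewrite (_ : perp_proj v = fun x => x + - dot x v *: v); last first.
    by apply/funext => x; rewrite scaleNr.
  apply: measurable_fun_rVD; first exact: measurable_id.
  apply: measurable_fun_rVZ; last exact: measurable_cst.
  apply: measurable_funN; apply: measurable_fun_dot; first exact: measurable_id.
  exact: measurable_cst.
apply: (measurableT_comp _ mP).
exact: (measurable_fun_within_compact compact_perp_proj cbeta).
Qed.

(** As the speed is constant along [v], the shear at time [t] is inverted by the one at time [- t];
    presenting the moved body as a preimage gives its measurability. *)
Lemma chord_movementE t :
  chord_movement v beta K t = [set y | K (y + - (chord_speed y * t) *: v)].
Proof.
apply/seteqP; split => [_ [x Kx <-]|y Ky] /=.
  by rewrite chord_speedDZ chord_speedE// -addrA -scalerDl subrr scale0r addr0.
exists (y + - (chord_speed y * t) *: v) => //.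
by rewrite -chord_speedE// chord_speedDZ -addrA -scalerDl addNr scale0r addr0.
Qed.

Lemma measurable_chord_movement t : measurable (chord_movement v beta K t).
Proof.
rewrite chord_movementE -[X in measurable X]setTI.
have mS : measurable_fun setT (fun y : 'rV[R]_n => y + - (chord_speed y * t) *: v).
  apply: measurable_fun_rVD; first exact: measurable_id.
  apply: measurable_fun_rVZ; last exact: measurable_cst.
  apply: measurable_funN; apply: measurable_funM; last exact: measurable_cst.
  exact: measurable_chord_speed.
exact: mS (compact_measurable_rV cK).
Qed.

Lemma ge0_integral_chord_movement t (f : 'rV[R]_n -> \bar R) :
    measurable_fun setT f -> (forall x, 0 <= f x)%E ->
  (\int[lebesgue_rV n]_(x in chord_movement v beta K t) f x =
   \int[lebesgue_rV n]_(x in K) f (x + (chord_speed x * t) *: v)%R)%E.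
Proof.
move=> mf f0; rewrite integral_mkcond [RHS]integral_mkcond.
have mg : measurable_fun setT ((fun x => chord_speed x * t) : _ -> measurableTypeR R).
  by apply: measurable_funM => //; exact: measurable_chord_speed.
have mfr : measurable_fun setT (f \_ (chord_movement v beta K t)).
  apply/(measurable_restrictT _ (measurable_chord_movement t)).
  exact: measurable_funS mf.
rewrite -(@ge0_integral_rV_shear R n v _ _ mg _ mfr); last 2 first.
- by move=> x a; rewrite chord_speedDZ.
- by move=> x; rewrite patchE; case: ifP.
apply: eq_integral => x _; rewrite !patchE.
suff -> : (x + (chord_speed x * t) *: v \in chord_movement v beta K t) = (x \in K) by [].
rewrite chord_movementE; apply/idP/idP; rewrite !inE/=.
  by rewrite chord_speedDZ -addrA -scalerDl subrr scale0r addr0.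
by rewrite chord_speedDZ -addrA -scalerDl subrr scale0r addr0.
Qed.

Lemma vol_chord_movement t : vol (chord_movement v beta K t) = vol K.
Proof.
have mC := measurable_chord_movement t; have mK := compact_measurable_rV cK.
have := @ge0_integral_chord_movement t (cst 1%E) (measurable_cst _) (fun=> lee01).
by rewrite !integral_cst// !mul1e.
Qed.

End chord_movement_measure.

Lemma one_sided_lipschitz_continuous (R : realType) (f : R -> R) (M : R) : 0 <= M ->
  (forall r r' : R, f r <= f r' + `|r - r'| * M) -> continuous f.
Proof.
move=> M0 lip; move=> r; apply/(@cvgrPdist_le _ R) => e e0; near=> r'.
have rr : `|r - r'| * M <= e.
  (* [M + 1] rather than [M], which may be 0. *)
  have : `|r - r'| <= e / (M + 1).
    near: r'; apply: (@cvgr_dist_le _ R); first exact: cvg_id.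
    by rewrite divr_gt0// ltr_wpDl.
  move=> /(ler_wpM2r M0) /le_trans; apply.
  rewrite -mulrA ger_pMr// mulrC ler_pdivrMr ?mul1r ?ltr_wpDl//.
  by rewrite lerDl.
have h1 := lip r r'; have h2 := lip r' r; rewrite distrC in h2.
rewrite ler_norml; apply/andP; split; lra.
Unshelve. all: by end_near. Qed.

Section Lp_support_chord_movement.
Context {R : realType} {n : nat}.
Variables (v : 'rV[R]_n) (K : set 'rV[R]_n) (beta : 'rV[R]_n -> R).
Hypotheses (v1 : dot v v = 1) (cK : compact K).
Hypothesis cbeta : {within perp_proj v @` K, continuous beta}.
Local Notation speed := (chord_speed v K beta).
Local Notation Kt t := (chord_movement v beta K t).
Local Notation mu := (lebesgue_rV n).

(* For fixed <v, y> this exponent is affine in the pair (y, t). *)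
Definition chord_exponent t (y x : 'rV[R]_n) : R := dot x y + speed x * t * dot v y.

Lemma chord_exponentE t x y : dot (x + (speed x * t) *: v) y = chord_exponent t y x.
Proof. by rewrite dotDl dotZl. Qed.

Lemma chord_exponentZ r t y x : chord_exponent t (r *: y) x = r * chord_exponent t y x.
Proof. by rewrite /chord_exponent !dotZr mulrDr; congr (_ + _); rewrite mulrCA. Qed.

Let mK : measurable K := compact_measurable_rV cK.

Lemma mbounded_chord_exponent c t y : mbounded K (fun x => c * chord_exponent t y x).
Proof.
split.
  apply: measurable_funTS; apply: measurable_funM => //.
  apply: measurable_funD.
    by apply: measurable_fun_dot; [exact: measurable_id|exact: measurable_cst].
  apply: measurable_funM => //; apply: measurable_funM => //.
  exact: measurable_chord_speed.
have [M1 h1] := compact_rV_bounded cK (continuous_subspaceT (@continuous_dotl R n y)).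
have [M2 h2] := compact_rV_bounded (compact_perp_proj (v := v) cK) cbeta.
exists (`|c| * (M1 + M2 * `|t| * `|dot v y|)) => x Kx.
rewrite normrM ler_wpM2l// (le_trans (ler_normD _ _))// lerD//; first exact: h1.
rewrite !normrM !ler_wpM2r//; rewrite chord_speedE//.
by apply: h2; exists x.
Qed.

Lemma Lp_support_chord_movement p t y : Lp_support p (Kt t) y =
  p^-1 * ln ((fine (vol K))^-1 * \int[mu]_(x in K) expR (p * chord_exponent t y x)).
Proof.
rewrite /Lp_support (vol_chord_movement v1 cK cbeta).
congr (_ * ln (_ * _)); rewrite /Rintegral; congr fine.
rewrite (ge0_integral_chord_movement v1 cK cbeta).
- by apply: eq_integral => x _; rewrite chord_exponentE.
- apply/measurable_EFinP; apply: (measurableT_comp (@measurable_expR R)).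
  apply: measurable_funM => //.
  by apply: measurable_fun_dot; [exact: measurable_id|exact: measurable_cst].
- by move=> x; rewrite lee_fin expR_ge0.
Qed.

(* The hypothesis covers infinite volume too; then Lp_support is p^-1 * ln 0 = 0. *)
Lemma Lp_support_chord_movement0 p t y : fine (vol K) = 0 -> Lp_support p (Kt t) y = 0.
Proof. by move=> V0; rewrite Lp_support_chord_movement V0 invr0 mul0r ln0// mulr0. Qed.

(** [fine] sends [+oo] to 0, so a nonzero value excludes null and infinite volume at once. *)
Let finite_volume : fine (vol K) != 0 -> (0 < mu K)%E /\ (mu K < +oo)%E.
Proof.
move=> V0; have Vp : 0 < fine (vol K) by rewrite lt_def V0 fine_ge0.
by move: Vp; rewrite /vol; case: (lebesgue_rV n K) => [r| |] /=; rewrite ?ltxx// ltry lte_fin.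
Qed.

Lemma Lp_support_log_exp_integral p t y : fine (vol K) != 0 ->
  Lp_support p (Kt t) y =
  p^-1 * (log_exp_integral mu K (fun x => p * chord_exponent t y x) - ln (fine (vol K))).
Proof.
move=> V0; rewrite Lp_support_chord_movement; congr (_ * _).
have [VK0 VKoo] := finite_volume V0.
have Vp : 0 < fine (vol K) by rewrite lt_def V0 fine_ge0.
rewrite lnM ?posrE ?invr_gt0//; last first.
  exact: (exp_integral_gt0 mK VK0 VKoo (mbounded_chord_exponent _ _ _)).
by rewrite lnV ?posrE// addrC.
Qed.

(** Lipschitz in [r]: the exponent is [r] times a function bounded on [K], and its factor [p]
    cancels [p^-1]. This continuity is what makes the radial primitives differentiable. *)
Lemma continuous_Lp_support_ray p t y : 0 < p ->
  continuous (fun r : R => Lp_support p (Kt t) (r *: y)).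
Proof.
move=> p0; have [V0|V0] := eqVneq (fine (vol K)) 0.
  rewrite (_ : (fun r => _) = cst 0); first exact: cst_continuous.
  by apply/funext => r; rewrite Lp_support_chord_movement0.
have [VK0 VKoo] := finite_volume V0.
have [_ [M hM]] := mbounded_chord_exponent 1 t y.
have M0 : 0 <= `|M| by [].
have lip (r r' : R) : Lp_support p (Kt t) (r *: y) <=
    Lp_support p (Kt t) (r' *: y) + `|r - r'| * `|M|.
  rewrite (Lp_support_log_exp_integral p t (r *: y) V0).
  rewrite (Lp_support_log_exp_integral p t (r' *: y) V0).
  have scale (A B l e : R) : A <= B + p * e -> p^-1 * (A - l) <= p^-1 * (B - l) + e.
    move=> AB; rewrite -[e](mulKf (negbT (gt_eqF p0))) -mulrDr.
    by rewrite ler_pM2l ?invr_gt0// addrAC lerD2r.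
  apply: scale; apply: (log_exp_integral_le_add mK VK0 VKoo); try exact: mbounded_chord_exponent.
  move=> x Kx; rewrite !chord_exponentZ -mulrDr ler_pM2l// addrC -lerBlDr -mulrBl.
  rewrite (le_trans (ler_norm _))// normrM ler_wpM2l//.
  by have := hM x Kx; rewrite mul1r => /le_trans; apply; exact: ler_norm.
exact: (one_sided_lipschitz_continuous M0 lip).
Qed.

(** With Hölder weights [z / (x + z)] and [x / (x + z)], the exponent at the midpoint is exactly the
    weighted mean of the other two; the common value of [dot v] is what lets the terms in time
    split. *)
Lemma Lp_support_harmonic_le p t1 t2 y1 y2 (x z : R) : 0 < p ->
    dot v y1 = dot v y2 -> 0 < x -> 0 < z ->
  Lp_support p (Kt ((t1 + t2) / 2)) (2 * (x^-1 + z^-1)^-1 *: (2^-1 *: (y1 + y2))) <=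
  (z * Lp_support p (Kt t1) (x *: y1) + x * Lp_support p (Kt t2) (z *: y2)) / (x + z).
Proof.
move=> p0 vy x0 z0.
have xz0 : 0 < x + z by rewrite addr_gt0.
have [V0|V0] := eqVneq (fine (vol K)) 0.
  by rewrite !Lp_support_chord_movement0// !mulr0 addr0 mul0r.
have [VK0 VKoo] := finite_volume V0.
rewrite !(Lp_support_log_exp_integral _ _ _ V0).
set a1 := log_exp_integral _ _ (fun x0 => p * chord_exponent t1 _ x0).
set a2 := log_exp_integral _ _ (fun x0 => p * chord_exponent t2 _ x0).
set a3 := log_exp_integral _ _ _.
have -> : (z * (p^-1 * (a1 - ln (fine (vol K)))) +
    x * (p^-1 * (a2 - ln (fine (vol K))))) / (x + z) =
    p^-1 * ((z / (x + z)) * a1 + (x / (x + z)) * a2 - ln (fine (vol K))).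
  by field; rewrite !gt_eqF.
rewrite ler_pM2l ?invr_gt0// lerD2r.
apply: (log_exp_integral_convex mK VK0 VKoo); try exact: mbounded_chord_exponent.
- by rewrite divr_ge0// ltW.
- by rewrite divr_ge0// ltW.
- by field; rewrite gt_eqF.
move=> w Kw; rewrite !chord_exponentZ /chord_exponent !dotDr vy.
rewrite le_eqVlt; apply/orP; left; apply/eqP; field.
by rewrite !gt_eqF// addr_gt0.
Qed.

End Lp_support_chord_movement.

Section Lp_polar_radial.
Context {R : realType} {n : nat}.

(** A divergent integral gives norm 0 and both sides hold. A finite one is positive by continuity
    along the ray, so the power [- n%:R^-1] simply reverses the inequality. *)
Lemma Lp_polarP (p : R) (K : set 'rV[R]_n) y : (0 < n)%N ->
    continuous (fun r : R => Lp_support p K (r *: y)) ->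
  Lp_polar p%:E K y <->
  ((n.-1`!%:R)%:E <= radial_integral n.-1 (fun r => Lp_support p K (r *: y)))%E.
Proof.
move=> n0 cL; rewrite /Lp_polar /= /Lp_polar_norm.
rewrite -/(radial_integral n.-1 (fun r => Lp_support p K (r *: y))).
have := radial_integral_gt0 n.-1 cL.
have f0 : (0 : R) < n.-1`!%:R by rewrite ltr0n fact_gt0.
case: (radial_integral _ _) => [j| |]//; last first.
  by rewrite gt0_muley ?lte_fin ?invr_gt0// leey.
rewrite lte_fin => j0; rewrite -EFinM.
have a0 : 0 < n.-1`!%:R^-1 * j by rewrite mulr_gt0 ?invr_gt0.
rewrite lee_fin powRN invf_le1 ?powR_gt0//.
have -> : (1 <= (n.-1`!%:R^-1 * j) `^ n%:R^-1) = (n.-1`!%:R <= j).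
  rewrite -[RHS](ler_pM2l (_ : 0 < n.-1`!%:R^-1)) ?invr_gt0// mulVf ?gt_eqF//.
  rewrite /powR gt_eqF// -[X in X <= expR _]expR0 ler_expR.
  by rewrite pmulr_rge0 ?invr_gt0 ?ltr0n// -[X in X <= ln _]ln1 ler_ln ?posrE.
by [].
Qed.

(** Tonelli for a jointly measurable integrand, the indicator of [K] replacing the domain of
    integration. *)
Lemma measurable_Lp_support (p : R) (K : set 'rV[R]_n) : measurable K ->
  measurable_fun setT (Lp_support p K : _ -> measurableTypeR R).
Proof.
move=> mK; apply: measurable_funM => //.
apply: (measurableT_comp (@measurable_ln R)).
apply: measurable_funM => //.
pose f (q : 'rV[R]_n * 'rV[R]_n) : \bar R := (expR (p * dot q.2 q.1) * \1_K q.2)%:E.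
have mf : measurable_fun setT f.
  apply/measurable_EFinP; apply: measurable_funM.
    apply: (measurableT_comp (@measurable_expR R)); apply: measurable_funM => //.
    by apply: measurable_fun_dot; [exact: measurable_snd|exact: measurable_fst].
  have mi : measurable_fun setT (\1_K : 'rV[R]_n -> measurableTypeR R).
    exact: measurable_indic.
  exact: (measurableT_comp mi measurable_snd).
rewrite (_ : (fun y => _) = fine \o fubini_F (lebesgue_rV n) f).
  apply: (measurableT_comp (fine_measurable measurableT)).
  apply: measurable_fun_fubini_tonelli_F => // q.
  by rewrite lee_fin mulr_ge0 ?expR_ge0.
apply/funext => y; rewrite /Rintegral /= /fubini_F; congr fine.
rewrite [LHS]integral_mkcond; apply: eq_integral => x _; rewrite patchE /f /= indicE.
by case: ifPn => _; rewrite ?mulr1 ?mulr0.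
Qed.

Lemma measurable_radial_integral_Lp_support (p : R) (K : set 'rV[R]_n) N :
  measurable K ->
  measurable_fun setT
    (fun y : 'rV[R]_n => radial_integral N (fun r => Lp_support p K (r *: y))).
Proof.
move=> mK.
pose f (q : 'rV[R]_n * measurableTypeR R) : \bar R :=
  (`|q.2| ^+ N * expR (- Lp_support p K ((q.2 : R) *: q.1)) * \1_(`[0%R, +oo[%classic) q.2)%:E.
have mf : measurable_fun setT f.
  apply/measurable_EFinP; apply: measurable_funM.
    apply: measurable_funM.
      by apply: measurable_funX; apply: (measurableT_comp (normr_measurable (D := setT))).
    apply: (measurableT_comp (@measurable_expR R)); apply: measurable_funN.
    apply: (measurableT_comp (measurable_Lp_support p mK)).
    by apply: measurable_fun_rVZ; [exact: measurable_snd|exact: measurable_fst].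
  by apply: measurableT_comp; [exact: measurable_indic|exact: measurable_snd].
rewrite (_ : (fun y => _) = fubini_F lebesgue_measure f).
  apply: measurable_fun_fubini_tonelli_F => // q.
  by rewrite lee_fin !mulr_ge0 ?exprn_ge0 ?expR_ge0.
apply/funext => y; rewrite /fubini_F /radial_integral [LHS]integral_mkcond.
apply: eq_integral => r _; rewrite patchE /f /= indicE.
case: ifPn => [/set_mem|]; rewrite /= ?in_itv/= ?andbT ?mulr0// => r0.
by rewrite mulr1 ger0_norm.
Qed.

Lemma closed_polar (K : set 'rV[R]_n) : closed (polar K).
Proof.
have -> : polar K = \bigcap_(x in K) [set y | dot y x <= 1].
  by apply/seteqP; split => [y h x Kx|y h x Kx]; have := h x Kx; rewrite /= dotC.
apply: closed_bigI => x _.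
apply: (closed_comp _ (@closed_le R 1)) => y _.
exact: continuous_dotl.
Qed.

End Lp_polar_radial.

(** * Sections of the polar bodies *)

Section root_brunn_minkowski.
Context {R : realType}.

(** Brunn-Minkowski is applied with [C] dilated by 2 and the result scaled back; the bounds by
    powers then become roots, infinite volumes being treated apart. *)
Lemma brunn_minkowski_midpoint N (A B C : set 'rV[R]_N) : (0 < N)%N ->
    measurable A -> measurable B -> measurable C -> A !=set0 -> B !=set0 ->
    (forall x y, A x -> B y -> C (2^-1 *: (x + y))) ->
  ((2^-1)%R%:E * poweR (lebesgue_rV N A) (N%:R^-1)%R
   + (2^-1)%R%:E * poweR (lebesgue_rV N B) (N%:R^-1)%R
   <= poweR (lebesgue_rV N C) (N%:R^-1)%R)%E.
Proof.
move=> N0 mA mB mC A0 B0 ABC.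
have h0 : (0 : R) < 2^-1 by rewrite invr_gt0.
have mC' : measurable [set x : 'rV[R]_N | C (2^-1 *: x)].
  by rewrite -[X in measurable X]setTI; exact: (measurable_rV_scale (2^-1)).
have BM (a b : R) : 0 <= a -> 0 <= b -> ((a ^+ N)%:E <= lebesgue_rV N A)%E ->
    ((b ^+ N)%:E <= lebesgue_rV N B)%E ->
    (((2^-1 * (a + b)) ^+ N)%:E <= lebesgue_rV N C)%E.
  move=> a0 b0 aA bB; rewrite -(lebesgue_rV_dilate h0 mC) exprMn EFinM.
  apply: lee_wpmul2l; first by rewrite lee_fin exprn_ge0// ltW.
  exact: (brunn_minkowski_rV mA mB mC' A0 B0 _ a0 b0 aA bB).
have N1 : N%:R^-1 != 0 :> R by rewrite invr_neq0// pnatr_eq0 -lt0n.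
have NV0 : 0 <= N%:R^-1 :> R by rewrite invr_ge0.
have powK (a : R) : 0 <= a -> (a ^+ N) `^ N%:R^-1 = a.
  move=> a0; rewrite -powR_mulrn// -powRrM mulfV ?powRr1//.
  by rewrite pnatr_eq0 -lt0n.
have root (a : R) : 0 <= a -> (a `^ N%:R^-1) ^+ N = a.
  move=> a0; rewrite -powR_mulrn ?powR_ge0// -powRrM mulVf ?powRr1//.
  by rewrite pnatr_eq0 -lt0n.
have A_ge0 : (0 <= lebesgue_rV N A)%E by exact: measure_ge0.
have B_ge0 : (0 <= lebesgue_rV N B)%E by exact: measure_ge0.
have C_ge0 : (0 <= lebesgue_rV N C)%E by exact: measure_ge0.
move: (lebesgue_rV N A) (lebesgue_rV N B) (lebesgue_rV N C) BM A_ge0 B_ge0 C_ge0.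
move=> x y z BM x0 y0 z0.
have powmono (a b : R) : 0 <= a -> 0 <= b -> ((a ^+ N)%:E <= x)%E -> ((b ^+ N)%:E <= y)%E ->
    ((2^-1 * (a + b))%:E <= z `^ N%:R^-1)%E.
  move=> a0 b0 ax by_; have c0 : 0 <= 2^-1 * (a + b) by rewrite mulr_ge0 ?addr_ge0// ltW.
  rewrite -(powK _ c0) -poweR_EFin; apply: gt0_ler_poweR => //.
  - by rewrite in_itv/= leey lee_fin exprn_ge0.
  - by rewrite in_itv/= leey z0.
  - exact: BM.
(* An infinite volume dominates every power, so the values 2|t| and 0 for [a] and [b] push the root
   of [z] above any [t]. *)
have top : (x = +oo \/ y = +oo)%E -> (z `^ N%:R^-1 = +oo)%E.
  move=> xy; apply: eq_infty => t.
  apply: (@le_trans _ _ (2^-1 * (`|t| *+ 2))%:E).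
    by rewrite -[X in (_ * X)%:E]mulr_natr mulrCA mulVf ?mulr1 ?lee_fin ?ler_norm// pnatr_eq0.
  case: xy => E; rewrite E in powmono.
  - rewrite -[X in _ * X]addr0; apply: powmono => //; rewrite ?leey ?expr0n ?mulrn_wge0//.
    by rewrite gtn_eqF.
  - rewrite -[X in _ * X]add0r; apply: powmono => //; rewrite ?leey ?expr0n ?mulrn_wge0//.
    by rewrite gtn_eqF.
case: x x0 BM powmono top => [x| |]// x0 BM powmono top; last by rewrite top ?leey//; left.
case: y y0 BM powmono top => [y| |]// y0 BM powmono top; last by rewrite top ?leey//; right.
rewrite !poweR_EFin -!EFinM -EFinD -mulrDr; rewrite lee_fin in x0; rewrite lee_fin in y0.
by apply: powmono; rewrite ?powR_ge0// root.
Qed.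

End root_brunn_minkowski.

Lemma measurable_mulmxr (R : realType) m n (E : 'M[R]_(m, n)) :
  measurable_fun setT (fun c : 'rV[R]_m => c *m E).
Proof.
apply: measurable_fun_rVP => i.
rewrite (_ : _ \o _ = fun c : 'rV[R]_m => \sum_j c 0 j * E j i).
  by apply: measurable_sum => j; apply: measurable_funM => //; exact: measurable_rV_coord.
by apply/funext => c; rewrite /rV_coord /= mxE.
Qed.

(** Stacking [v] on the frame [E] gives a square matrix with orthonormal rows, hence orthonormal
    columns: v^T v + E^T E = 1. On [x] orthogonal to [v] only the second term survives. *)
Lemma perp_frame_span (R : realType) n (v x : 'rV[R]_n) : dot v v = 1 -> dot x v = 0 ->
  exists c, x = c *m perp_frame v.
Proof.
move=> v1 xv; have [EE Ev] := perp_frameP v1; exists (x *m (perp_frame v)^T).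
case: n v x v1 xv EE Ev => [|n] v x v1 xv EE Ev; first exact: rV0_eq.
move: (perp_frame v) EE Ev => E /= EE Ev.
pose M : 'M[R]_(1 + n, n.+1) := col_mx v E.
have MM : M *m M^T = 1%:M.
  rewrite /M tr_col_mx mul_col_row EE Ev.
  have -> : v *m v^T = 1%:M by apply/matrixP => i j; rewrite !ord1 [LHS]v1 mxE.
  have -> : v *m E^T = 0 by rewrite -[LHS]trmxK trmx_mul trmxK Ev trmx0.
  by rewrite -scalar_mx_block.
have := mulmx1C MM; rewrite /M tr_col_mx mul_row_col => vE.
rewrite -mulmxA -[LHS]mulmx1 -vE mulmxDr !mulmxA.
have -> : x *m v^T = 0 by apply/matrixP => i j; rewrite !ord1 [LHS]xv mxE.
by rewrite mul0mx add0r.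
Qed.

Section polar_sections.
Context {R : realType} {n : nat}.
Variables (p : \bar R) (v : 'rV[R]_n) (K : set 'rV[R]_n) (beta : 'rV[R]_n -> R).
Hypotheses (n2 : (2 <= n)%N) (p0 : (0 < p)%E) (v1 : dot v v = 1) (cK : compact K).
Hypothesis cbeta : {within perp_proj v @` K, continuous beta}.
Local Notation Kt t := (chord_movement v beta K t).

Lemma measurable_Lp_polar t : measurable (Lp_polar p (Kt t)).
Proof.
case: p p0 => [q| |]//= q0; last first.
  by apply: closed_measurable_rV; exact: closed_polar.
have mKt := measurable_chord_movement v1 cK cbeta t.
have -> : [set y | Lp_polar_norm q (Kt t) y <= 1] =
    [set y | (n.-1`!%:R%:E <= radial_integral n.-1 (fun r => Lp_support q (Kt t) (r *: y)))%E].
  apply/seteqP; split => y; have := @Lp_polarP R n q (Kt t) y (ltnW n2)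
    (continuous_Lp_support_ray v1 cK cbeta (t := t) (y := y) q0); by move=> [].
rewrite -[X in measurable X]setTI.
apply: emeasurable_fun_c_infty => //.
exact: measurable_radial_integral_Lp_support.
Qed.

Lemma Lp_polar_midpoint t1 t2 y1 y2 : dot v y1 = dot v y2 ->
    Lp_polar p (Kt t1) y1 -> Lp_polar p (Kt t2) y2 ->
  Lp_polar p (Kt ((t1 + t2) / 2)) (2^-1 *: (y1 + y2)).
Proof.
move=> vy; move: p0; case: p => [q q0|_|]; last by [].
  have cL t y := continuous_Lp_support_ray v1 cK cbeta (t := t) (y := y) q0.
  move=> /(Lp_polarP (ltnW n2) (cL _ _)) P1 /(Lp_polarP (ltnW n2) (cL _ _)) P2.
  apply/(Lp_polarP (ltnW n2) (cL _ _)).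
  apply: radial_integral_harmonic_le P1 P2; try exact: cL.
    by move=> x z x0 z0; exact: Lp_support_harmonic_le.
  by rewrite ltr0n fact_gt0.
(* For [p = +oo], the pairing of [y] with the moved point is affine in [y] and time at fixed
   [dot v y]: the inequality at the midpoint is the mean of those for the same [x]. *)
move=> /= P1 P2 _ [x Kx <-].
have := P1 _ (ex_intro2 _ _ x Kx erefl); have := P2 _ (ex_intro2 _ _ x Kx erefl).
rewrite !dotDl !dotZl dotZr !dotDr dotZr dotDr vy.
set b := beta _; set s := dot v y2 => h1 h2.
lra.
Qed.

End polar_sections.

(* The last two hypotheses on s, t1, t2 only exclude the situation where one
   of the two sections is empty while the other one has positive volume: the
   Brunn-Minkowski-type inequality is then false in general with |set0| = 0. *)
Theorem theorem1p2 (R : realType) (n : nat) (p : \bar R)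
    (v : 'rV[R]_n) (K : set 'rV[R]_n) (beta : 'rV[R]_n -> R) :
  (2 <= n)%N -> (0 < p)%E -> dot v v = 1 ->
  convex_body K ->
  {within perp_proj v @` K, continuous beta} ->
  forall s t1 t2 : R,
  admissible_times v beta K t1 -> admissible_times v beta K t2 ->
  let A t := perp_section v (Lp_polar p (chord_movement v beta K t)) s in
  ((0 < perp_vol v (A t1))%E -> A t2 !=set0) ->
  ((0 < perp_vol v (A t2))%E -> A t1 !=set0) ->
  ((2^-1)%R%:E * poweR (perp_vol v (A t1)) (n.-1%:R^-1)%R
   + (2^-1)%R%:E * poweR (perp_vol v (A t2)) (n.-1%:R^-1)%R
   <= poweR (perp_vol v (A ((t1 + t2) / 2)%R)) (n.-1%:R^-1)%R)%E.
Proof.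
move=> n2 p0 v1 [cK _ _] cbeta s t1 t2 _ _ A ne1 ne2.
have [_ Ev] := perp_frameP v1.
have dotE c : dot (c *m perp_frame v) v = 0 by rewrite /dot -mulmxA Ev mulmx0 mxE.
pose D t := [set c | Lp_polar p (chord_movement v beta K t) (c *m perp_frame v + s *: v)].
have volD t : perp_vol v (A t) = lebesgue_rV n.-1 (D t).
  rewrite /perp_vol; congr (lebesgue_rV n.-1 _); apply/seteqP; split => c /=; first by case.
  by move=> Dc; split => //; exact: dotE.
have mD t : measurable (D t).
  rewrite -[X in measurable X]setTI; have mL := measurable_Lp_polar n2 p0 v1 cK cbeta t.
  apply: (@measurable_fun_rVD _ _ R n (fun c : 'rV[R]_n.-1 => c *m perp_frame v)
    (fun=> s *: v)) mL => //.
  exact: measurable_mulmxr.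
have D0 t : A t !=set0 -> D t !=set0.
  move=> [x [xv Ax]]; have [c xE] := perp_frame_span v1 xv.
  by exists c; rewrite /D /= -xE.
have nz (B : set 'rV[R]_n.-1) : (0 < lebesgue_rV n.-1 B)%E -> B !=set0.
  by move=> B0; apply/set0P; apply: contraTneq B0 => ->; rewrite measure0 ltxx.
rewrite !volD in ne1 ne2 *.
have N0 : (0 < n.-1)%N by rewrite -subn1 subn_gt0.
have mid x y : D t1 x -> D t2 y -> D ((t1 + t2) / 2) (2^-1 *: (x + y)).
  move=> D1 D2; rewrite /D /=.
  have -> : 2^-1 *: (x + y) *m perp_frame v + s *: v =
      2^-1 *: ((x *m perp_frame v + s *: v) + (y *m perp_frame v + s *: v)).
    rewrite -scalemxAl mulmxDl addrACA -scalerDl [in RHS]scalerDr scalerA.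
    by congr (_ + _ *: _); field.
  apply: Lp_polar_midpoint => //.
  by rewrite !dotDr -!(dotC _ v) !dotE.
(* One positive volume makes both sections nonempty, by [ne1] or [ne2], and Brunn-Minkowski applies.
   If both vanish, so does the left side, because the exponent is nonzero: a zero exponent would
   give 1. *)
have [X1|X1] := eqVneq (lebesgue_rV n.-1 (D t1)) 0%E; last first.
  have p1 : (0 < lebesgue_rV n.-1 (D t1))%E by rewrite lt0e X1 measure_ge0.
  by apply: brunn_minkowski_midpoint => //; [exact: nz|exact/D0/ne1].
have [X2|X2] := eqVneq (lebesgue_rV n.-1 (D t2)) 0%E; last first.
  have p2 : (0 < lebesgue_rV n.-1 (D t2))%E by rewrite lt0e X2 measure_ge0.
  by apply: brunn_minkowski_midpoint => //; [exact/D0/ne2|exact: nz].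
rewrite X1 X2 poweR_EFin powR0; last by rewrite invr_neq0// pnatr_eq0 -lt0n.
by rewrite !mule0 adde0 poweR_ge0.
Qed.
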